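(* Let $(f,g)$ be consistent Cauchy data and assume that the solution $\bar\varphi$ of the fixed point equation $T_l\varphi+z_{f,g}=\varphi$ satisfies the source condition $$\bar\varphi-\varphi_1=F(I-T_l)\,\psi\qquad\text{for some }\psi\in\mathcal{H},$$ where $\varphi_1\in\mathcal{H}$ is some initial guess and $F$ is the function $$F(\lambda)=\bigl(\ln(e\,\lambda^{-1})\bigr)^{-p}\ \ (\lambda>0),\qquad F(0)=0,$$ with $p\ge1$. Let $\mu>2$, let $(f_\varepsilon,g_\varepsilon)$ be some given noisy data with $\|z_\varepsilon-z_{f,g}\|\le\varepsilon$, $\varepsilon>0$, let $\varphi_1^\varepsilon:=\varphi_1$, $\varphi_{k+1}^\varepsilon:=T_l\varphi_k^\varepsilon+z_\varepsilon$ for $k\ge1$, and let $$k_\varepsilon:=k(\varepsilon,z_\varepsilon):=\min\{k\in\mathbb{N}\ :\ \|z_\varepsilon-(I-T_l)\varphi_k^\varepsilon\|\le\mu\varepsilon\}$$ be the stopping index determined by the discrepancy principle. Then, as $\varepsilon\to0$, (i) $k_\varepsilon\,(\ln k_\varepsilon)^p=O(\varepsilon^{-1})$; (ii) $\|\bar\varphi-\varphi_{k_\varepsilon}^\varepsilon\|\le O\bigl((-\ln\sqrt{\varepsilon})^{-p}\bigr)$.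
   Context: Setting. $\Omega\subset\mathbb{R}^2$ is an open bounded regular set and $\partial\Omega$ is split into $\Gamma_1,\Gamma_2$ with $\Gamma_1\cap\Gamma_2=\emptyset$ and $\overline{\Gamma_1\cup\Gamma_2}=\partial\Omega$. $P u=-\sum_{i,j=1}^2 D_i(a_{i,j}D_ju)$ with coefficients $a_{i,j}\in L_\infty(\Omega)$ such that $\xi^t(a_{i,j}(x))\xi>\alpha\|\xi\|^2$ for a.e. $x\in\Omega$ and all nonzero $\xi\in\mathbb{R}^2$, with $\alpha>0$ independent of $x$. $u_{\nu_A}$ denotes the conormal derivative associated with $P$. Cauchy data $(f,g)\in H^{1/2}(\Gamma_1)\times H^{1/2}_{00}(\Gamma_1)'$ are consistent if there is an $H^1(\Omega)$-solution $u$ (it is then unique) of $Pu=0$ in $\Omega$, $u=f$ and $u_{\nu_A}=g$ at $\Gamma_1$. Operator. Let $\mathcal{H}:=H^{1/2}_{00}(\Gamma_2)'$. Define $L_n:\mathcal{H}\to H^{1/2}(\Gamma_2)$, $L_n(\varphi)=w|_{\Gamma_2}$, where $w\in H^1(\Omega)$ solves $Pw=0$ in $\Omega$, $w=f$ at $\Gamma_1$, $w_{\nu_A}=\varphi$ at $\Gamma_2$; and $L_d:H^{1/2}(\Gamma_2)\to\mathcal{H}$, $L_d(\psi)=v_{\nu_A}|_{\Gamma_2}$, where $v\in H^1(\Omega)$ solves $Pv=0$ in $\Omega$, $v_{\nu_A}=g$ at $\Gamma_1$, $v=\psi$ at $\Gamma_2$. Set $T:=L_d\circ L_n:\mathcal{H}\to\mathcal{H}$.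 $T$ is affine, $T\varphi=T_l\varphi+z_{f,g}$, with linear part $T_l$ (independent of the data) and affine term $z_{f,g}\in\mathcal{H}$. For consistent data the equation $T\varphi=\varphi$ has the unique solution $\bar\varphi=u_{\nu_A}|_{\Gamma_2}$. For any Cauchy data $(f_\varepsilon,g_\varepsilon)\in H^{1/2}(\Gamma_1)\times H^{1/2}_{00}(\Gamma_1)'$, consistent or not, $z_\varepsilon\in\mathcal{H}$ denotes the affine term obtained by the same construction with $(f_\varepsilon,g_\varepsilon)$ in place of $(f,g)$ (if $f_\varepsilon$ is only in $L^2(\Gamma_1)$, it is first replaced by a smoothed version in $H^{1/2}(\Gamma_1)$). Norm. For $\varphi\in\mathcal{H}$ let $W(\varphi)\in H^1(\Omega)$ solve $Pw=0$ in $\Omega$, $w=0$ at $\Gamma_1$, $w_{\nu_A}=\varphi$ at $\Gamma_2$. $\mathcal{H}$ carries the inner product $\langle\varphi,\psi\rangle_*=\int_\Omega\nabla W(\varphi)\cdot\nabla W(\psi)\,dx$; $\|\cdot\|$ denotes the induced norm, which is equivalent to the usual norm of $\mathcal{H}$. It is known that, for this inner product, $T_l$ is self-adjoint, non-negative and non-expansive, and $I-T_l$ is self-adjoint, positive, non-expansive and compact; $F(I-T_l)$ is defined by the functional calculus of self-adjoint operators. Convention. The constants in the $O(\cdot)$ terms do not depend on $\varepsilon$. *)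

(* Defs.v *)
(* Conventions (MathComp-Analysis):
   - R^2 is [R * R] with the product of two Lebesgue measures;
   - H^1(Omega) is the space of pairs of a function and its weak gradient;
   - H^{1/2}(G) is the quotient of H^1(Omega) by the functions of zero trace
     on G: its elements are cosets, and [trace G u] is the coset of u;
   - H^{1/2}_{00}(N) consists of the traces on N of the functions of
     H^1(Omega) with zero trace on the complementary part D of the boundary;
     its dual is the type [H00dual Omega N D];
   - a conormal derivative is the functional given by Green's formula. *)
From HB Require Import structures.
From mathcomp Require Import all_boot all_order all_algebra.
From mathcomp Require Import all_classical all_reals all_analysis.
Set Implicit Arguments.
Unset Strict Implicit.
Unset Printing Implicit Defensive.
Import Order.TTheory GRing.Theory Num.Theory.
Import numFieldNormedType.Exports.
Local Open Scope classical_set_scope.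
Local Open Scope ring_scope.

Section plane.
Context {R : realType}.
Local Notation plane := (R * R)%type.
Implicit Types (Omega G D N : set plane) (h : plane -> R).

Local Notation mu2 := ((@lebesgue_measure R) \x (@lebesgue_measure R))%E.

Definition basis_vec (i : 'I_2) : plane := if i == 0 then (1, 0) else (0, 1).

Definition partial (i : 'I_2) h : plane -> R := fun x => 'D_(basis_vec i) h x.

Definition iter_partial (s : seq 'I_2) h : plane -> R := foldr partial h s.

(* C^infinity on the plane *)
Definition smooth h : Prop := forall s : seq 'I_2,
  continuous (iter_partial s h) /\
  forall i x, derivable (iter_partial s h) x (basis_vec i).

(* C_c^infinity(Omega) *)
Definition test_fun Omega h : Prop :=
  smooth h /\
  exists K : set plane,
    [/\ compact K, K `<=` Omega & forall x, ~ K x -> h x = 0].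

Definition bdry Omega : set plane := closure Omega `\` interior Omega.

(* Regularity of the set is read as its weakest usual form: in suitable
   orthonormal coordinates (t, s) centred at any given boundary point, Omega
   is locally the set below the graph of a Lipschitz function. *)
Definition lipschitz_boundary Omega : Prop :=
  forall x, bdry Omega x ->
  exists (c d r L : R) (gamma : R -> R),
    [/\ c ^+ 2 + d ^+ 2 = 1, 0 < r,
        forall t t', `|gamma t - gamma t'| <= L * `|t - t'| &
        forall t s, `|t| < r -> `|s| < r ->
          Omega (x.1 + t * c - s * d, x.2 + t * d + s * c) <-> s < gamma t].

Definition regular_domain Omega : Prop :=
  [/\ open Omega, bounded_set Omega & lipschitz_boundary Omega].

Definition boundary_split Omega G1 G2 : Prop :=
  G1 `&` G2 = set0 /\ closure (G1 `|` G2) = bdry Omega.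

(* A function together with a candidate for its gradient. *)
Local Notation jet := ((plane -> R) * ('I_2 -> plane -> R))%type.

Definition grad (u : jet) (i : 'I_2) : plane -> R := u.2 i.

Definition jet_of h : jet := (h, fun i => partial i h).

Definition L2 Omega h : Prop :=
  measurable_fun Omega h /\ (\int[mu2]_(x in Omega) ((h x) ^+ 2)%:E < +oo)%E.

Definition H1 Omega (u : jet) : Prop :=
  [/\ L2 Omega u.1, forall i, L2 Omega (grad u i) &
      forall h i, test_fun Omega h ->
        \int[mu2]_(x in Omega) (u.1 x * partial i h x) =
        - \int[mu2]_(x in Omega) (grad u i x * h x)].

Definition H1norm Omega (u : jet) : R :=
  Num.sqrt (\int[mu2]_(x in Omega)
              (u.1 x ^+ 2 + \sum_(i < 2) grad u i x ^+ 2)).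

(* u = 0 at G: u is the H^1-limit of functions that are smooth up to the
   boundary and vanish on G. *)
Definition zero_trace Omega G (u : jet) : Prop :=
  H1 Omega u /\
  exists h : nat -> plane -> R,
    [/\ forall n, smooth (h n), forall n x, G x -> h n x = 0 &
        H1norm Omega (u - jet_of (h n)) @[n --> \oo] --> (0 : R)].

Definition trace Omega G (u : jet) : set jet :=
  [set w | H1 Omega w /\ zero_trace Omega G (w - u)].

Definition Hhalf Omega G : set (set jet) :=
  [set f | exists2 u, H1 Omega u & f = trace Omega G u].

(* Bounded linear functionals on H^{1/2}_{00}(N), seen as functionals of v in
   { v in H^1 : v = 0 at D } that only depend on the trace of v on N. They are
   extended by 0 outside this space, so that equality of functionals is
   equality of functions. *)
Definition H00dual_pred Omega N D (phi : jet -> R) : Prop :=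
  [/\ forall v, ~ zero_trace Omega D v -> phi v = 0,
      forall (c : R) u v, zero_trace Omega D u -> zero_trace Omega D v ->
        phi (c *: u + v) = c * phi u + phi v,
      forall v, zero_trace Omega D v -> zero_trace Omega N v -> phi v = 0 &
      exists C : R, forall v, zero_trace Omega D v ->
        `|phi v| <= C * H1norm Omega v].

Lemma H00dual_pred_submod Omega N D :
  submod_closed [pred phi : jet -> R | `[< H00dual_pred Omega N D phi >]].
Proof.
split=> [|c phi psi].
  apply/asboolP; split=> //= [c u v _ _|]; first by rewrite mulr0 addr0.
  by exists 0 => v _; rewrite mul0r normr0.
move=> /asboolP[p1 p2 p3 [C p4]] /asboolP[q1 q2 q3 [C' q4]].
have E v : (c *: phi + psi) v = c * phi v + psi v by [].
apply/asboolP; split.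
- by move=> v v0; rewrite E p1// q1// mulr0 addr0.
- move=> a u v u0 v0; rewrite !E p2// q2//.
  by rewrite !mulrDr addrACA mulrCA.
- by move=> v v0 v0'; rewrite E p3// q3// mulr0 addr0.
- exists (`|c| * C + C') => v v0; rewrite E (le_trans (ler_normD _ _))//.
  by rewrite mulrDl lerD// ?q4// normrM -mulrA ler_wpM2l// p4.
Qed.

HB.instance Definition _ Omega N D := GRing.isSubmodClosed.Build R (jet -> R)
  [pred phi : jet -> R | `[< H00dual_pred Omega N D phi >]]
  (H00dual_pred_submod Omega N D).

Record H00dual Omega N D := MkH00dual {
  H00dual_fun :> jet -> R;
  _ : H00dual_fun \in
        [pred phi : jet -> R | `[< H00dual_pred Omega N D phi >]] }.

HB.instance Definition _ Omega N D := [isSub for @H00dual_fun Omega N D].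
HB.instance Definition _ Omega N D := [Choice of H00dual Omega N D by <:].
HB.instance Definition _ Omega N D :=
  [SubChoice_isSubLmodule of H00dual Omega N D by <:].


(* Standing assumptions on the coefficients of P u = - sum_ij D_i (a_ij D_j u) *)
Definition bounded_coefficients Omega (a : plane -> 'M[R]_2) : Prop :=
  forall i j, measurable_fun Omega (fun x => a x i j) /\
    exists M : R, {ae mu2, forall x, Omega x -> `|a x i j| <= M}.

Definition uniformly_elliptic Omega (a : plane -> 'M[R]_2) (alpha : R) : Prop :=
  {ae mu2, forall x, Omega x -> forall xi : 'cV[R]_2, xi != 0 ->
    alpha * (\sum_(i < 2) xi i 0 ^+ 2) < (xi^T *m a x *m xi) 0 0}.

Section Cauchy_problem.
Context (Omega : set plane) (a : plane -> 'M[R]_2).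

Definition energy (u v : jet) : R :=
  \int[mu2]_(x in Omega)
    \sum_(i < 2) \sum_(j < 2) (a x i j * grad u j x * grad v i x).

(* P u = 0 in Omega, in the sense of distributions *)
Definition P_null (u : jet) : Prop :=
  forall h, test_fun Omega h -> energy u (jet_of h) = 0.

(* u_{nu_A} = phi at N, where D is the complementary part of the boundary *)
Definition conormal N D (u : jet) (phi : H00dual Omega N D) : Prop :=
  forall v, zero_trace Omega D v -> energy u v = phi v.

(* P w = 0 in Omega, w = f at D, w_{nu_A} = phi at N *)
Definition mixed_solution D N (f : set jet) (phi : H00dual Omega N D)
    (w : jet) : Prop :=
  [/\ H1 Omega w, P_null w, trace Omega D w = f & conormal w phi].

Definition mixed_solvable D N : Prop :=
  forall f (phi : H00dual Omega N D), Hhalf Omega D f ->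
  exists w, mixed_solution f phi w.

Definition consistent G1 G2 (f : set jet) (g : H00dual Omega G1 G2) : Prop :=
  exists u,
    [/\ H1 Omega u, P_null u, trace Omega G1 u = f & conormal u g].

Context (G1 G2 : set plane).

Local Notation H := (H00dual Omega G2 G1).

(* L_n(phi) = w|_{G2} *)
Definition Ln (f : set jet) (phi : H) : set jet :=
  trace Omega G2 (xget 0 [set w | mixed_solution f phi w]).

(* L_d(psi) = v_{nu_A}|_{G2} *)
Definition Ld (g : H00dual Omega G1 G2) (psi : set jet) : H :=
  xget 0 [set chi | exists2 v, mixed_solution psi g v & conormal v chi].

Definition Tmap (f : set jet) (g : H00dual Omega G1 G2) (phi : H) : H :=
  Ld g (Ln f phi).

(* The linear part of T, which does not depend on the data, is obtained with
   zero data; the affine term is the value of T at 0. *)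
Definition Tl : H -> H := Tmap (trace Omega G1 0) 0.

Definition zterm (f : set jet) (g : H00dual Omega G1 G2) : H := Tmap f g 0.

Definition Wsol (phi : H) : jet :=
  xget 0 [set w | mixed_solution (trace Omega G1 0) phi w].

Definition star (phi psi : H) : R :=
  \int[mu2]_(x in Omega)
    \sum_(i < 2) (grad (Wsol phi) i x * grad (Wsol psi) i x).

Definition starnorm (phi : H) : R := Num.sqrt (star phi phi).

Definition iterate (phi1 z : H) (k : nat) : H :=
  iter k.-1 (fun phi => Tl phi + z) phi1.

Definition residual (phi1 z : H) (k : nat) : R :=
  let phik := iterate phi1 z k in starnorm (z - (phik - Tl phik)).

(* Indices start at 1. *)
Definition discrepancy_index (phi1 z : H) (tau : R) (k : nat) : Prop :=
  [/\ (0 < k)%N, residual phi1 z k <= tau &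
      forall j, (0 < j < k)%N -> tau < residual phi1 z j].

End Cauchy_problem.

Section functional_calculus.
Context {V : lmodType R}.

Definition poly_op (S : V -> V) (q : {poly R}) (v : V) : V :=
  \sum_(i < size q) q`_i *: iter i S v.

(* w = F(S) v for a self-adjoint operator S such that 0 <= S <= I, whose
   spectrum is thus contained in [0, 1], and F continuous on [0, 1]: F(S) is
   the limit of q_n(S) for polynomials q_n converging to F uniformly on
   [0, 1]; it does not depend on the choice of the q_n. *)
Definition continuous_calculus (nrm : V -> R) (F : R -> R) (S : V -> V)
    (v w : V) : Prop :=
  exists q : nat -> {poly R},
    {uniform `[0, 1]%classic, (fun n x => (q n).[x]) @ \oo --> F} /\
    nrm (w - poly_op S (q n) v) @[n --> \oo] --> (0 : R).

End functional_calculus.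

Definition source_fun (p lambda : R) : R :=
  if lambda == 0 then 0 else ln (expR 1 / lambda) `^ (- p).

End plane.

(* Main.v *)
Require Import Defs.
From HB Require Import structures.
From mathcomp Require Import all_boot all_order all_algebra.
From mathcomp Require Import all_classical all_reals all_analysis.
From mathcomp Require Import measurable_realfun ring lra zify.
Set Implicit Arguments.
Unset Strict Implicit.
Unset Printing Implicit Defensive.
Import Order.TTheory GRing.Theory Num.Theory.
Import numFieldNormedType.Exports.
Local Open Scope classical_set_scope.
Local Open Scope ring_scope.

(** Write [S = I - T] for the operator [T] of the fixed point iteration, [w]
    for the initial error [phibar - phi1 = F(S) psi], and count the iterations
    from 0.

    By induction on [n] ([fp_residualE], [fp_error_le]), the residual of the
    noisy iterate is [T^n (z_eps - z) + S T^n w], and its error differs from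
    [T^n w] by a vector of norm at most [n * eps]. As [T] is nonexpansive, the
    residual is within [eps] of its noise-free value [S T^n w], whose norm is
    at most [sup x (1 - x)^n F(x)], the supremum being over [0, 1], times the
    norm of [psi]. This supremum is attained near [x = 1/n] and is
    [O(1 / (n (ln n)^p))] ([source_fun_decay]). So the discrepancy principle
    stops. At the index just before stopping the residual still exceeds
    [mu * eps], hence the noise-free one exceeds [(mu - 1) * eps], and this
    bounds the stopping index: rate (i), [stopping_index_rate].

    For (ii), the pointwise inequality
    [F(x)^2 <= F(d)^2 + d^-2 (x F(x))^2] says that an element of the range of
    [F(S)] is small once its image by [S] is small ([conditional_stability]).
    At the stopping index that image is the noise-free residual, at most
    [(mu + 1) * eps]. For [d = sqrt eps] the first term has the required order,
    as [F(sqrt eps) <= (- ln (sqrt eps))^-p], and the second one is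
    [O(sqrt eps)], which is smaller. The propagated noise [n * eps] is at
    most [sqrt eps] if [n <= 1 / sqrt eps], and is controlled by (i) otherwise,
    since then [ln n >= - ln (sqrt eps)] ([logarithmic_rate]).

    These estimates turn an inequality between functions on [0, 1] into one
    between operators. The continuous calculus is defined through polynomials,
    so all that is needed is that [q(S)] is nonnegative when [q] is
    nonnegative on [0, 1]. This holds in any real inner product space, with no
    completeness and no spectral theorem: [S^a (1 - S)^b] is nonnegative, and
    [q] is approximated by its Bernstein sums ([poly_functional_ge0],
    [poly_op_ge0]).

    It remains to see that the form [star] is an inner product. If two
    functions vanish on [G1] and have the same conormal derivative on [G2],
    the energy of their difference is zero, hence by ellipticity so is its
    gradient; so the gradient of [W(phi)] is linear in [phi]
    ([star_semi_inner]). If it vanishes, so does the functional [phi]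
    ([star_definite]). A symmetric map for an inner product is linear
    ([symmetric_linear]), which gives the linearity of [T]. *)

(** * Positive functionals on polynomials *)

Lemma bin_mul_ffact n m k : (m <= k <= n)%N ->
  ('C(n, k) * k ^_ m = n ^_ m * 'C(n - m, k - m))%N.
Proof.
move=> /andP[mk kn]; have mn := leq_trans mk kn.
apply/eqP; rewrite -(@eqn_pmul2r ((k - m)`! * (n - k)`!)) ?muln_gt0 ?fact_gt0//.
apply/eqP.
rewrite [LHS](_ : _ = 'C(n, k) * (k ^_ m * (k - m)`!) * (n - k)`!)%N; last ring.
rewrite ffact_fact// -mulnA bin_fact//.
rewrite [RHS](_ : _ =
  n ^_ m * ('C(n - m, k - m) * ((k - m)`! * (n - k)`!)))%N; last ring.
rewrite (_ : (n - k = n - m - (k - m))%N); last lia.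
by rewrite bin_fact ?leq_sub2r// ffact_fact.
Qed.

Section Bernstein.
Context {R : realType}.

(** The Bernstein sum of the function taking [k / n] to
    [k ^_ m / n ^_ m] is exactly ['X^m]: expand
    ['X^m = 'X^m * ('X + (1 - 'X)) ^+ (n - m)]. *)
Lemma bernstein_Xn n m : (m <= n)%N -> 'X^m =
  \sum_(k < n.+1) ((k ^_ m)%:R / (n ^_ m)%:R * 'C(n, k)%:R) *:
    ('X^k * (1 - 'X) ^+ (n - k)) :> {poly R}.
Proof.
move=> mn.
rewrite -(big_mkord predT (fun k => ((k ^_ m)%:R / (n ^_ m)%:R * 'C(n, k)%:R) *:
    ('X^k * (1 - 'X) ^+ (n - k)))).
rewrite (@big_cat_nat _ _ _ m)//=; last exact: leqW.
rewrite big_nat big1 ?add0r; last first.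
  by move=> k /andP[_ km]; rewrite ffact_small// !mul0r scale0r.
rewrite -{2}(add0n m) big_addn subSn// big_mkord.
have E1 : (1 - 'X + 'X) ^+ (n - m) = 1 :> {poly R} by rewrite subrK expr1n.
rewrite -[LHS]mulr1 -[X in _ * X = _]E1 exprDn mulr_sumr.
apply: eq_bigr => i _.
have ilt : (i <= n - m)%N by rewrite -ltnS.
have : (m <= i + m <= n)%N by rewrite leq_addl; lia.
move=> /bin_mul_ffact; rewrite addnK => E.
rewrite mulrAC -natrM mulnC E natrM mulrAC divff; last first.
  by rewrite pnatr_eq0 -lt0n ffact_gt0.
rewrite mul1r scaler_nat mulrnAr; congr (_ *+ _).
by rewrite exprD (addnC i m) subnDA mulrCA mulrC (mulrC 'X^m).
Qed.

(** From [m] to [m + 1] one ratio is multiplied by [(k - m) / (n - m)], the other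
    by [k / n]. These factors differ by at most [m / n], and everything is at
    most 1, so the errors add up to at most [m ^ 2 / n]. *)
Lemma ffact_ratio_approx n m k : (0 < n)%N -> (m <= n)%N -> (k <= n)%N ->
  `|(k ^_ m)%:R / (n ^_ m)%:R - (k%:R / n%:R) ^+ m| <= (m ^ 2)%:R / n%:R :> R.
Proof.
move=> n0; elim: m => [|m IH] mn kn.
  by rewrite !ffactn0 divr1 expr0 subrr normr0 mul0r.
have [mk|km] := leqP m k; last first.
  rewrite ffact_small ?mul0r ?sub0r ?normrN; last exact: leqW.
  have mn' : (m <= n)%N := ltnW mn.
  have := IH mn' kn; rewrite ffact_small// mul0r sub0r normrN => H.
  rewrite exprS normrM.
  have : `|k%:R / n%:R| <= 1 :> R.
    by rewrite ger0_norm ?divr_ge0// ler_pdivrMr ?ltr0n// mul1r ler_nat.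
  move=> H1; apply: le_trans (ler_pM _ _ H1 H) _ => //.
  rewrite mul1r ler_pM2r ?invr_gt0 ?ltr0n// ler_nat leq_exp2r//.
have := IH (ltnW mn) kn; set A := (k ^_ m)%:R / _; set x := k%:R / n%:R => H.
have -> : (k ^_ m.+1)%:R / (n ^_ m.+1)%:R = A * ((k - m)%:R / (n - m)%:R) :> R.
  by rewrite /A !ffactnSr !natrM invfM mulrACA.
have x01 : 0 <= x <= 1.
  by rewrite divr_ge0//= ler_pdivrMr ?ltr0n// mul1r ler_nat.
have A01 : 0 <= A <= 1.
  rewrite divr_ge0//= ler_pdivrMr ?ltr0n ?ffact_gt0 ?(ltnW mn)// mul1r ler_nat.
  elim: (m) => [|j IHj]; first by rewrite !ffactn0.
  by rewrite !ffactnSr leq_mul// leq_sub2r.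
set y := _ / _.
have yx : `|y - x| <= m%:R / n%:R.
  have nm0 : (0 < (n - m)%:R :> R) by rewrite ltr0n subn_gt0.
  have n0R : (0 < n%:R :> R) by rewrite ltr0n.
  have -> : y - x = - ((m%:R / n%:R) * ((n - k)%:R / (n - m)%:R)).
    rewrite /y /x natrB// !natrB ?(ltnW mn)//.
    field; rewrite -natrB ?(ltnW mn)// !gt_eqF//.
  rewrite normrN normrM ger0_norm ?divr_ge0// ler_piMr ?divr_ge0//.
  by rewrite ger0_norm ?divr_ge0// ler_pdivrMr// mul1r ler_nat leq_sub2l.
rewrite exprS.
have -> : A * y - x * x ^+ m = A * (y - x) + x * (A - x ^+ m) by ring.
apply: le_trans (ler_normD _ _) _; rewrite (normrM A) (normrM x).
case/andP: x01 => x0 x1; case/andP: A01 => A0 A1.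
rewrite (ger0_norm A0) (ger0_norm x0).
apply: le_trans (lerD (ler_piMl _ A1) (ler_piMl _ x1)) _ => //.
apply: le_trans (lerD yx H) _.
rewrite -mulrDl -natrD ler_pM2r ?invr_gt0 ?ltr0n// ler_nat.
by rewrite !expnS !expn0; lia.
Qed.

(** A form of the Hausdorff moment theorem. The numbers
    ['C(n, k) * L ('X^k * (1 - 'X) ^+ (n - k))] are the weights of a positive
    measure carried by the points [k / n]; [L Q] is the integral of [Q] for
    this measure up to an error [C / n], with [C] independent of [n]. *)
Lemma poly_functional_ge0 (L : {poly R} -> R) :
  (forall (c : R) q r, L (c *: q + r) = c * L q + L r) ->
  (forall a b, 0 <= L ('X^a * (1 - 'X) ^+ b)) ->
  forall Q, (forall x : R, 0 <= x <= 1 -> 0 <= Q.[x]) -> 0 <= L Q.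
Proof.
move=> Llin Lpos Q Qpos.
have L0 : L 0 = 0.
  have /eqP := Llin 1 0 0; rewrite scale1r addr0 mul1r.
  by rewrite -subr_eq0 opprD addNKr oppr_eq0 => /eqP.
have LD q r : L (q + r) = L q + L r by have := Llin 1 q r; rewrite scale1r mul1r.
have LZ c q : L (c *: q) = c * L q by have := Llin c q 0; rewrite !addr0 L0 addr0.
have Lsum (I : finType) (E : I -> {poly R}) : L (\sum_i E i) = \sum_i L (E i).
  by rewrite (big_morph L LD L0).
pose C := (\sum_(m < size Q) `|Q`_m| * (m ^ 2)%:R) * L 1.
have key n : (0 < n)%N -> (size Q <= n)%N -> - (C / n%:R) <= L Q.
  move=> n0 Qn.
  pose be (k : 'I_n.+1) := 'C(n, k)%:R * L ('X^k * (1 - 'X) ^+ (n - k)).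
  have be0 k : 0 <= be k by rewrite mulr_ge0.
  have LX m : (m <= n)%N ->
      L 'X^m = \sum_(k < n.+1) (k ^_ m)%:R / (n ^_ m)%:R * be k.
    move=> mn; rewrite {1}(bernstein_Xn mn) Lsum; apply: eq_bigr => k _.
    by rewrite LZ /be mulrA.
  have L1 : L 1 = \sum_(k < n.+1) be k.
    rewrite -(expr0 'X) LX//; apply: eq_bigr => k _.
    by rewrite !ffactn0 divr1 mul1r.
  have -> : L Q = \sum_(k < n.+1) be k *
      (\sum_(m < size Q) Q`_m * ((k ^_ m)%:R / (n ^_ m)%:R)).
    rewrite -[Q in LHS]coefK poly_def Lsum.
    under eq_bigr => m _.
      rewrite LZ LX; last by rewrite (leq_trans _ Qn)// ltnW.
      rewrite mulr_sumr; over.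
    rewrite exchange_big /=; apply: eq_bigr => k _; rewrite mulr_sumr.
    by apply: eq_bigr => m _; rewrite mulrA mulrC.
  have -> : - (C / n%:R) = \sum_(k < n.+1) be k *
      - (\sum_(m < size Q) `|Q`_m| * ((m ^ 2)%:R / n%:R)).
    rewrite -mulr_suml -L1 mulrN; congr (- _).
    rewrite /C [RHS]mulrC mulrAC; congr (_ * _).
    by rewrite mulr_suml; apply: eq_bigr => m _; rewrite mulrA.
  apply: ler_sum => k _; rewrite ler_wpM2l//.
  have kn : (k <= n)%N by rewrite -ltnS.
  have : 0 <= Q.[k%:R / n%:R].
    apply: Qpos; rewrite divr_ge0//= ler_pdivrMr ?ltr0n// mul1r ler_nat//.
  rewrite horner_coef => H.
  rewrite lerNl; apply: le_trans (_ : \sum_(m < size Q) Q`_m * ((k%:R / n%:R) ^+ m -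
      (k ^_ m)%:R / (n ^_ m)%:R) <= _).
    under [leRHS]eq_bigr => m _ do rewrite mulrBr.
    by rewrite sumrB -[leLHS]add0r lerD2r.
  apply: ler_sum => m _; apply: le_trans (ler_norm _) _.
  rewrite normrM ler_wpM2l// distrC ffact_ratio_approx//.
  by rewrite (leq_trans _ Qn)// ltnW.
rewrite leNgt; apply/negP => LQ.
have C0 : 0 <= C.
  apply: mulr_ge0; first by apply: sumr_ge0 => i _; rewrite mulr_ge0.
  by have := Lpos 0%N 0%N; rewrite !expr0 mulr1.
pose n := (maxn (size Q) (Num.truncn (C / - L Q)).+1).
have n0 : (0 < n)%N by rewrite /n leq_max orbT.
have := key n n0 (leq_maxl _ _).
rewrite lerNl ler_pdivlMr ?ltr0n// mulrC -ler_pdivlMr ?oppr_gt0// leNgt.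
move=> /negP; apply.
apply: lt_le_trans (truncnS_gt _) _.
by rewrite ler_nat leq_maxr.
Qed.

End Bernstein.

(** * Inner products *)

Section semi_inner_product.
Context {R : realType} {V : lmodType R}.

Definition semi_inner (B : V -> V -> R) : Prop :=
  [/\ forall c u v w, B (c *: u + v) w = c * B u w + B v w,
      forall u v, B u v = B v u & forall u, 0 <= B u u].

Context (B : V -> V -> R) (B_inner : semi_inner B).

Let BC u v : B u v = B v u. Proof. by case: B_inner. Qed.
Let B_ge0 u : 0 <= B u u. Proof. by case: B_inner. Qed.

Lemma innerDl u v w : B (u + v) w = B u w + B v w.
Proof. by case: B_inner => + _ _ => /(_ 1 u v w); rewrite scale1r mul1r. Qed.

Lemma inner0l w : B 0 w = 0.
Proof. by have := innerDl 0 0 w; rewrite addr0; lra. Qed.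

Lemma innerZl c u w : B (c *: u) w = c * B u w.
Proof. by case: B_inner => + _ _ => /(_ c u 0 w); rewrite !addr0 inner0l addr0. Qed.

Lemma innerNl u w : B (- u) w = - B u w.
Proof. by rewrite -scaleN1r innerZl mulN1r. Qed.

Lemma innerBl u v w : B (u - v) w = B u w - B v w.
Proof. by rewrite innerDl innerNl. Qed.

Lemma innerDr u v w : B w (u + v) = B w u + B w v.
Proof. by rewrite BC innerDl ![B _ w]BC. Qed.

Lemma innerZr c u w : B w (c *: u) = c * B w u.
Proof. by rewrite BC innerZl [B _ w]BC. Qed.

Lemma innerBr u v w : B w (u - v) = B w u - B w v.
Proof. by rewrite BC innerBl ![B _ w]BC. Qed.

(** For a form that need not be definite: besides the inner product of the
    theorem, it is applied to [B (S u) v]. *)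
Lemma inner_cauchy_schwarz u v : B u v ^+ 2 <= B u u * B v v.
Proof.
have E (c d : R) : 0 <= c ^+ 2 * B u u - 2 * c * d * B u v + d ^+ 2 * B v v.
  have := B_ge0 (c *: u - d *: v).
  rewrite innerBl !innerBr !(innerZl, innerZr) (BC v u).
  by congr (_ <= _); ring.
have := B_ge0 v; rewrite le_eqVlt => /orP[/eqP v0|v0].
  rewrite -v0 mulr0.
  (* a null vector is orthogonal to everything *)
  have := E (B u v) (B u u + 1); rewrite -v0.
  have := B_ge0 u; set a := B u u; set b := B u v => a0.
  have := sqr_ge0 b; nra.
have := E (B v v) (B u v); set a := B u u; set b := B u v.
rewrite [X in 0 <= X](_ : _ = B v v * (a * B v v - b ^+ 2)); last by ring.
by rewrite pmulr_rge0// subr_ge0.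
Qed.

Definition inner_norm u := Num.sqrt (B u u).
Local Notation nrm := inner_norm.

Lemma inner_norm_ge0 u : 0 <= nrm u. Proof. exact: sqrtr_ge0. Qed.

Lemma inner_norm_sqr u : nrm u ^+ 2 = B u u.
Proof. by rewrite sqr_sqrtr. Qed.

Lemma inner_le_norm u v : B u v <= nrm u * nrm v.
Proof.
apply: le_trans (ler_norm _) _.
rewrite -(@ler_pXn2r _ 2)// ?nnegrE ?mulr_ge0 ?inner_norm_ge0//.
by rewrite exprMn !inner_norm_sqr -normrX ger0_norm ?sqr_ge0 ?inner_cauchy_schwarz.
Qed.

Lemma inner_normD u v : nrm (u + v) <= nrm u + nrm v.
Proof.
rewrite -(@ler_pXn2r _ 2)// ?nnegrE ?addr_ge0 ?inner_norm_ge0//.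
rewrite sqrrD !inner_norm_sqr innerDl !innerDr (BC v u).
have := inner_le_norm u v; lra.
Qed.

Lemma inner_norm_opp u : nrm (- u) = nrm u.
Proof. by rewrite /nrm innerNl BC innerNl opprK. Qed.

Lemma inner_norm0 : nrm 0 = 0.
Proof. by rewrite /nrm inner0l sqrtr0. Qed.

Lemma inner_normB u v : nrm (u - v) = nrm (v - u).
Proof. by rewrite -inner_norm_opp opprB. Qed.

Lemma inner_norm_dist u v : `|nrm u - nrm v| <= nrm (u - v).
Proof.
rewrite ler_norml; apply/andP; split.
  rewrite lerNl opprB lerBlDr inner_normB.
  by rewrite -{1}(subrK u v) inner_normD.
by rewrite lerBlDr -{1}(subrK v u) inner_normD.
Qed.

(** The defect of linearity is orthogonal to every vector, because [A] can be
    moved to the other side; so it vanishes. *)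
Lemma symmetric_linear (A : V -> V) : (forall u, B u u = 0 -> u = 0) ->
  (forall u v, B (A u) v = B u (A v)) ->
  forall c u v, A (c *: u + v) = c *: A u + A v.
Proof.
move=> Bdef Asym c u v; apply/eqP; rewrite -subr_eq0; apply/eqP/Bdef.
set w := (X in B X X); rewrite {1}/w innerBl innerDl innerZl !Asym.
by rewrite innerDl innerZl subrr.
Qed.

End semi_inner_product.

(** * Polynomials of an operator between 0 and 1 *)

Section polynomial_calculus.
Context {R : realType} {V : lmodType R} (S : V -> V).
Context (S_linear : forall c u v, S (c *: u + v) = c *: S u + S v).

Let SD u v : S (u + v) = S u + S v.
Proof. by have := S_linear 1 u v; rewrite !scale1r. Qed.

Let S0 : S 0 = 0.
Proof. by apply: (addrI (S 0)); rewrite -SD !addr0. Qed.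

Let SZ c u : S (c *: u) = c *: S u.
Proof. by have := S_linear c u 0; rewrite !addr0 S0 addr0. Qed.

Lemma poly_op_widen n (q : {poly R}) v : (size q <= n)%N ->
  poly_op S q v = \sum_(i < n) q`_i *: iter i S v.
Proof.
move=> qn; rewrite /poly_op.
rewrite (big_ord_widen n (fun i => q`_i *: iter i S v))// big_mkcond/=.
apply: eq_bigr => i _; case: ifPn => // /negPf; rewrite ltnNge => /negbFE H.
by rewrite nth_default// scale0r.
Qed.

Lemma poly_opD q r v : poly_op S (q + r) v = poly_op S q v + poly_op S r v.
Proof.
pose n := maxn (size q) (size r).
rewrite !(@poly_op_widen n) ?leq_maxl ?leq_maxr ?size_polyD//.
by rewrite -big_split; apply: eq_bigr => i _ /=; rewrite coefD scalerDl.
Qed.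

Lemma poly_opZ c q v : poly_op S (c *: q) v = c *: poly_op S q v.
Proof.
rewrite (poly_op_widen v (size_scale_leq c q)) /poly_op scaler_sumr.
by apply: eq_bigr => i _; rewrite coefZ scalerA.
Qed.

Lemma poly_opC c v : poly_op S c%:P v = c *: v.
Proof.
by rewrite (poly_op_widen v (size_polyC_leq1 c)) big_ord1 coefC.
Qed.

Lemma poly_op0 v : poly_op S 0 v = 0.
Proof. by rewrite -polyC0 poly_opC scale0r. Qed.

Lemma poly_op1 v : poly_op S 1 v = v.
Proof. by rewrite -polyC1 poly_opC scale1r. Qed.

Lemma poly_opB q r v : poly_op S (q - r) v = poly_op S q v - poly_op S r v.
Proof. by rewrite poly_opD -(scaleN1r r) poly_opZ scaleN1r. Qed.

Lemma poly_op_linear q c u v :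
  poly_op S q (c *: u + v) = c *: poly_op S q u + poly_op S q v.
Proof.
rewrite /poly_op scaler_sumr -big_split; apply: eq_bigr => i _ /=.
have -> : iter i S (c *: u + v) = c *: iter i S u + iter i S v.
  by elim: (nat_of_ord i) => //= n ->; exact: S_linear.
by rewrite scalerDr !scalerA mulrC.
Qed.

Lemma poly_op_addr q u v : poly_op S q (u + v) = poly_op S q u + poly_op S q v.
Proof. by have := poly_op_linear q 1 u v; rewrite !scale1r. Qed.

Lemma poly_op_subr q u v : poly_op S q (u - v) = poly_op S q u - poly_op S q v.
Proof. by rewrite -(scaleN1r v) addrC poly_op_linear scaleN1r addrC. Qed.

Lemma poly_opMX q v : poly_op S (q * 'X) v = S (poly_op S q v).
Proof.
have Hs : (size (q * 'X)%R <= (size q).+1)%N.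
  have [->|q0] := eqVneq q 0; first by rewrite mul0r size_poly0.
  by rewrite size_mulX.
rewrite (poly_op_widen v Hs) big_ord_recl coefMX scale0r add0r /poly_op.
rewrite (big_morph S SD S0); apply: eq_bigr => i _.
by rewrite coefMX /= SZ.
Qed.

Lemma poly_opM q r v : poly_op S (q * r) v = poly_op S q (poly_op S r v).
Proof.
elim/poly_ind: q => [|q c IH]; first by rewrite mul0r !poly_op0.
rewrite mulrDl !poly_opD mulrAC !poly_opMX IH.
by rewrite mul_polyC poly_opZ poly_opC.
Qed.

Lemma poly_opX v : poly_op S 'X v = S v.
Proof. by rewrite -(mul1r 'X) poly_opMX poly_op1. Qed.

Lemma poly_op_onemX v : poly_op S (1 - 'X) v = v - S v.
Proof. by rewrite poly_opB poly_op1 poly_opX. Qed.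

Lemma poly_op_onemXn n v :
  poly_op S ((1 - 'X) ^+ n) v = iter n (fun u => u - S u) v.
Proof.
by elim: n => [|n IH]; rewrite ?poly_op1// exprS poly_opM IH poly_op_onemX.
Qed.

End polynomial_calculus.

Section spectral_bounds.
Context {R : realType} {V : lmodType R} (B : V -> V -> R) (S : V -> V).
Context (B_inner : semi_inner B).
Context (S_linear : forall c u v, S (c *: u + v) = c *: S u + S v).
Context (S_sym : forall u v, B (S u) v = B u (S v)).
Context (S_ge0 : forall u, 0 <= B (S u) u).
Context (S_le1 : forall u, B (S u) u <= B u u).

Local Notation nrm := (inner_norm B).
Let BC u v : B u v = B v u. Proof. by case: B_inner. Qed.
Let B_ge0 u : 0 <= B u u. Proof. by case: B_inner. Qed.

(** [S ^ 2 <= S], that is, [S (1 - S) >= 0]: this is the Cauchy-Schwarz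
    inequality for the form [B (S u) v], applied to [u] and [S u]. *)
Lemma contraction_sqr_le u : B (S u) (S u) <= B (S u) u.
Proof.
have HS : semi_inner (fun u v => B (S u) v).
  split=> // [c x y z|x y]; last by rewrite S_sym BC.
  by rewrite S_linear (innerDl B_inner) (innerZl B_inner).
have := inner_cauchy_schwarz HS u (S u) => /=.
have := S_le1 (S u); have := S_ge0 u; have := B_ge0 (S u).
set a := B (S u) (S u); set b := B (S u) u; set c := B (S (S u)) (S u).
move=> a0 b0 ca aabc.
have [->//|a0'] := eqVneq a 0.
have {}a0 : 0 < a by rewrite lt_def a0'.
rewrite -(ler_pM2l a0); apply: le_trans (_ : b * c <= _); first by rewrite -expr2.
by rewrite mulrC ler_wpM2r.
Qed.

Lemma poly_op_sym q u v : B (poly_op S q u) v = B u (poly_op S q v).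
Proof.
elim/poly_ind: q u v => [|q c IH] u v.
  by rewrite !poly_op0 (inner0l B_inner) BC (inner0l B_inner).
rewrite !poly_opD !poly_opC (innerDl B_inner) (innerDr B_inner).
rewrite (innerZl B_inner) (innerZr B_inner).
by rewrite (poly_opM S_linear q 'X v) poly_opX// poly_opMX// S_sym IH.
Qed.

(** Even powers are squares of a symmetric operator; only the parities of [a]
    and [b] matter, and the four remaining operators [1], [S], [1 - S] and
    [S (1 - S)] are nonnegative. *)
Lemma poly_op_mono_ge0 a b v : 0 <= B (poly_op S ('X^a * (1 - 'X) ^+ b) v) v.
Proof.
pose s : {poly R} := 'X^(a./2) * (1 - 'X) ^+ b./2.
pose r : {poly R} := 'X^(odd a) * (1 - 'X) ^+ (odd b).
have -> : 'X^a * (1 - 'X) ^+ b = s * (r * s).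
  rewrite -{1}(odd_double_half a) -{1}(odd_double_half b) /r /s.
  rewrite -!addnn !exprD; ring.
rewrite poly_opM// poly_op_sym poly_opM//.
set u := poly_op S s v; rewrite /r.
case: (odd a); case: (odd b); rewrite /= ?expr1 ?expr0 ?mulr1 ?mul1r.
- rewrite mulrC poly_opM// poly_opX// poly_op_onemX// (innerBl B_inner) subr_ge0.
  by rewrite (S_sym (S u)) contraction_sqr_le.
- by rewrite poly_opX.
- by rewrite poly_op_onemX// (innerBl B_inner) subr_ge0.
- by rewrite poly_op1.
Qed.

Lemma poly_op_ge0 q v : (forall x : R, 0 <= x <= 1 -> 0 <= q.[x]) ->
  0 <= B (poly_op S q v) v.
Proof.
apply: (@poly_functional_ge0 _ (fun q => B (poly_op S q v) v)) => [c p r|a b].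
  by rewrite poly_opD poly_opZ (innerDl B_inner) (innerZl B_inner).
exact: poly_op_mono_ge0.
Qed.

Lemma poly_op_norm_sqr q v : nrm (poly_op S q v) ^+ 2 = B (poly_op S (q ^+ 2) v) v.
Proof. by rewrite inner_norm_sqr// poly_op_sym expr2 -poly_opM// BC. Qed.

(** The norms are values of the quadratic forms of [q ^+ 2] and
    [(q * 'X) ^+ 2], so that the inequality says that the operator of the
    polynomial [A%:P + C *: (q * 'X) ^+ 2 - q ^+ 2] is nonnegative. With
    [C = 0] this is the bound of the operator norm by the supremum norm. *)
Lemma poly_op_interpolation q A C v :
  (forall x : R, 0 <= x <= 1 -> q.[x] ^+ 2 <= A + C * (x * q.[x]) ^+ 2) ->
  nrm (poly_op S q v) ^+ 2 <=
    A * nrm v ^+ 2 + C * nrm (S (poly_op S q v)) ^+ 2.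
Proof.
move=> H; rewrite -(poly_opMX S_linear) !poly_op_norm_sqr inner_norm_sqr//.
rewrite -subr_ge0 -!(innerZl B_inner) -(innerDl B_inner) -(innerBl B_inner).
have := @poly_op_ge0 (A%:P + C *: (q * 'X) ^+ 2 - q ^+ 2) v.
rewrite poly_opB poly_opD poly_opC poly_opZ; apply=> x x01.
rewrite hornerD hornerN hornerD hornerC hornerZ !horner_exp hornerM hornerX.
by rewrite subr_ge0 (mulrC _ x); exact: H.
Qed.

Lemma poly_op_bound q M v : 0 <= M ->
  (forall x : R, 0 <= x <= 1 -> `|q.[x]| <= M) ->
  nrm (poly_op S q v) <= M * nrm v.
Proof.
move=> M0 H; rewrite -(@ler_pXn2r _ 2)// ?nnegrE ?mulr_ge0 ?inner_norm_ge0//.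
have := @poly_op_interpolation q (M ^+ 2) 0 v; rewrite mul0r addr0 exprMn.
apply=> x x01; rewrite mul0r addr0.
by rewrite -[leLHS]real_normK ?num_real// ler_pXn2r ?nnegrE// H.
Qed.

Lemma poly_op_bounded q : exists2 M, 0 <= M &
  (forall x : R, 0 <= x <= 1 -> `|q.[x]| <= M) /\
  forall v, nrm (poly_op S q v) <= M * nrm v.
Proof.
have M0 : 0 <= \sum_(i < size q) `|q`_i| by exact: sumr_ge0.
have H (x : R) : 0 <= x <= 1 -> `|q.[x]| <= \sum_(i < size q) `|q`_i|.
  move=> /andP[x0 x1]; rewrite horner_coef.
  apply: le_trans (ler_norm_sum _ _ _) _; apply: ler_sum => i _.
  by rewrite normrM ler_piMr// ger0_norm ?exprn_ge0// exprn_ile1.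
by exists (\sum_(i < size q) `|q`_i|) => //; split=> // v; exact: poly_op_bound.
Qed.

End spectral_bounds.

(** * Bounds for the continuous functional calculus *)

Lemma uniform_itv_near {R : realType} (q : nat -> {poly R}) (F : R -> R) :
  {uniform `[0, 1]%classic, (fun n x => (q n).[x]) @ \oo --> F} ->
  forall e, 0 < e ->
  \forall n \near \oo, forall x, 0 <= x <= 1 -> `|F x - (q n).[x]| < e.
Proof.
move=> U e e0.
apply: (U [set h | forall x, 0 <= x <= 1 -> `|F x - h x| < e]).
apply/uniform_nbhs; exists [set xy | ball xy.1 e xy.2]; split.
  rewrite -entourage_ballE; exists e => //.
by move=> h /= H x x01; apply: H; rewrite /= in_itv.
Qed.

Section continuous_calculus_bounds.
Context {R : realType} {V : lmodType R} (B : V -> V -> R) (S : V -> V).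
Context (B_inner : semi_inner B).
Context (S_linear : forall c u v, S (c *: u + v) = c *: S u + S v).
Context (S_sym : forall u v, B (S u) v = B u (S v)).
Context (S_ge0 : forall u, 0 <= B (S u) u).
Context (S_le1 : forall u, B (S u) u <= B u u).
Context (F : R -> R).
Local Notation nrm := (inner_norm B).
Local Notation calculus := (continuous_calculus nrm F S).

Let pbounded := poly_op_bounded B_inner S_linear S_sym S_ge0 S_le1.

Lemma calculus_poly_op r v w : calculus v w ->
  calculus (poly_op S r v) (poly_op S r w).
Proof.
move=> [q [qF qw]]; exists q; split=> //.
have [M M0 [_ HM]] := pbounded r.
apply: (squeeze_cvgr _ (cvg_cst 0)).
  2: by rewrite -(mulr0 M); apply: cvgMr; exact: qw.
near=> n; rewrite inner_norm_ge0/=.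
by rewrite -poly_opM// mulrC poly_opM// -poly_op_subr// HM.
Unshelve. all: by end_near. Qed.

(** The operator norm of [r(S) F(S)] is at most the supremum of [r F] over
    [0, 1]: approximate [w] by [q_n(S) v] and [F] by [q_n] within [h]. *)
Lemma calculus_poly_bound r M v w : 0 <= M -> calculus v w ->
  (forall x : R, 0 <= x <= 1 -> `|r.[x] * F x| <= M) ->
  nrm (poly_op S r w) <= M * nrm v.
Proof.
move=> M0 [q [qF qw]] HM.
have [C C0 [rC HC]] := pbounded r.
apply/ler_addgt0Pr => e e0.
have K0 : 0 < C + C * nrm v + 1.
  by rewrite ltr_wpDl// addr_ge0// mulr_ge0// inner_norm_ge0.
pose h := e / (C + C * nrm v + 1).
have h0 : 0 < h by rewrite divr_gt0.
have Hn : \forall n \near \oo,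
    nrm (w - poly_op S (q n) v) < h /\
    forall x, 0 <= x <= 1 -> `|F x - (q n).[x]| < h.
  near=> n; split; last by near: n; exact: uniform_itv_near.
  rewrite -[ltLHS]ger0_norm ?inner_norm_ge0//; near: n.
  by have /cvgr0Pnorm_lt := qw; apply.
have [n [nw nF]] : exists n, nrm (w - poly_op S (q n) v) < h /\
    forall x, 0 <= x <= 1 -> `|F x - (q n).[x]| < h.
  by case: Hn => N _ /(_ N (leqnn N)) H; exists N.
rewrite -(subrK (poly_op S (q n) v) w) poly_op_addr//.
apply: le_trans (inner_normD B_inner _ _) _.
apply: le_trans (lerD (HC _) (_ : _ <= (M + C * h) * nrm v)) _.
  rewrite -poly_opM//; apply: poly_op_bound => // [|x x01].
    by rewrite addr_ge0// mulr_ge0// ltW.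
  rewrite hornerM.
  have -> : r.[x] * (q n).[x] = r.[x] * F x - r.[x] * (F x - (q n).[x]) by ring.
  apply: le_trans (ler_normB _ _) _; rewrite lerD ?HM//.
  by rewrite normrM ler_pM ?rC// ltW ?nF.
have : C * nrm (w - poly_op S (q n) v) <= C * h by rewrite ler_wpM2l// ltW.
have : h * (C + C * nrm v + 1) = e by rewrite divfK// gt_eqF.
rewrite [in X in _ -> _ -> X]mulrDl; move: h0; clearbody h.
move: (C * nrm (w - _)) (M * nrm v) (nrm v) => a c b.
lra.
Unshelve. all: by end_near. Qed.

(** The inequality between functions holds for the approximating polynomials
    up to an error proportional to [h], which goes to 0 after the passage to
    the limit in [n]. *)
Lemma calculus_interpolation A C v w : 0 <= A -> 0 <= C -> calculus v w ->
  (forall x : R, 0 <= x <= 1 -> `|F x| <= 1) ->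
  (forall x : R, 0 <= x <= 1 -> F x ^+ 2 <= A + C * (x * F x) ^+ 2) ->
  nrm w ^+ 2 <= A * nrm v ^+ 2 + C * nrm (S w) ^+ 2.
Proof.
move=> A0 C0 [q [qF qw]] F1 FAC.
have [M M0 [_ HM]] := pbounded 'X.
have cw : nrm (poly_op S (q n) v) @[n --> \oo] --> nrm w.
  apply: cvg_zero; apply: norm_cvg0.
  apply: (squeeze_cvgr _ (cvg_cst 0) qw).
  near=> n; rewrite normr_ge0/= distrC; exact: inner_norm_dist.
have cSw : nrm (S (poly_op S (q n) v)) @[n --> \oo] --> nrm (S w).
  apply: cvg_zero; apply: norm_cvg0.
  apply: (squeeze_cvgr _ (cvg_cst 0)).
    2: by rewrite -(mulr0 M); apply: cvgMr; exact: qw.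
  near=> n; rewrite normr_ge0/= distrC.
  apply: le_trans (inner_norm_dist B_inner _ _) _.
  by rewrite -!(poly_opX S_linear) -poly_op_subr.
have step h : 0 < h -> h <= 1 ->
    nrm w ^+ 2 <= (A + 3 * (1 + C) * h) * nrm v ^+ 2 + C * nrm (S w) ^+ 2.
  move=> h0 h1.
  have c1 : nrm (poly_op S (q n) v) ^+ 2 @[n --> \oo] --> nrm w ^+ 2.
    exact: (cvgM cw cw).
  have c2 : (A + 3 * (1 + C) * h) * nrm v ^+ 2 +
      C * nrm (S (poly_op S (q n) v)) ^+ 2 @[n --> \oo] -->
      (A + 3 * (1 + C) * h) * nrm v ^+ 2 + C * nrm (S w) ^+ 2.
    by apply: cvgD; [exact: cvg_cst|apply: cvgMr; exact: (cvgM cSw cSw)].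
  apply: (ler_cvg_to c1 c2); near=> n.
  apply: poly_op_interpolation => // x x01.
  have qFx : `|F x - (q n).[x]| < h.
    by move: x x01; near: n; exact: uniform_itv_near.
  have := F1 x x01; have := FAC x x01.
  case/andP: x01 => x0 x1.
  move: qFx; rewrite !ler_norml ltr_norml.
  set y := F x; set z := (q n).[x] => /andP[a1 a2] H /andP[b1 b2].
  have d1 : z ^+ 2 - y ^+ 2 <= 3 * h by nra.
  have d2 : y ^+ 2 - z ^+ 2 <= 3 * h by nra.
  have x2 : x ^+ 2 <= 1 by rewrite exprn_ile1.
  have d3 : (x * y) ^+ 2 <= (x * z) ^+ 2 + 3 * h.
    rewrite !exprMn -lerBlDl -mulrBr.
    apply: le_trans (_ : x ^+ 2 * (3 * h) <= _).
      by rewrite ler_wpM2l ?sqr_ge0.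
    by rewrite ler_piMl// mulr_ge0// ltW.
  have d4 : C * (x * y) ^+ 2 <= C * ((x * z) ^+ 2 + 3 * h) by rewrite ler_wpM2l.
  move: H d4 d1; rewrite mulrDr; set X := C * (x * z) ^+ 2; set Y := C * _ ^+ 2.
  lra.
apply/ler_addgt0Pr => e e0.
have K0 : 0 < 3 * (1 + C) * nrm v ^+ 2 + 1.
  by rewrite ltr_wpDl// !mulr_ge0// ?addr_ge0// ?inner_norm_ge0.
pose h := Num.min 1 (e / (3 * (1 + C) * nrm v ^+ 2 + 1)).
have h0 : 0 < h by rewrite lt_min ltr01 divr_gt0.
have h1 : h <= 1 by rewrite ge_min lexx.
have hK : h * (3 * (1 + C) * nrm v ^+ 2 + 1) <= e.
  by rewrite -ler_pdivlMr// ge_min lexx orbT.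
apply: le_trans (step _ h0 h1) _.
rewrite mulrDl addrAC lerD2l; apply: le_trans hK.
by rewrite -subr_ge0 [X in 0 <= X](_ : _ = h); [exact: ltW|ring].
Unshelve. all: by end_near. Qed.

End continuous_calculus_bounds.

(** * The logarithmic source function *)

Section source_function.
Context {R : realType}.
Implicit Types (p x y t : R).

Lemma powRVN x p : 0 <= x -> x^-1 `^ p = x `^ (- p).
Proof. by move=> x0; rewrite -powR_inv1// -powRrM mulN1r. Qed.

Lemma ler_powRN p x y : 0 <= p -> 0 < x -> x <= y -> y `^ (- p) <= x `^ (- p).
Proof.
move=> p0 x0 xy; have y0 := lt_le_trans x0 xy.
rewrite !powRN lef_pV2 ?posrE ?powR_gt0//.
by apply: ge0_ler_powR; rewrite ?nnegrE// ltW.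
Qed.

Lemma source_funE p x : 0 < x -> source_fun p x = (1 - ln x) `^ (- p).
Proof.
move=> x0; rewrite /source_fun gt_eqF// ln_div ?posrE ?expR_gt0// expRK//.
Qed.

Lemma source_fun0 p : source_fun p 0 = 0 :> R.
Proof. by rewrite /source_fun eqxx. Qed.

Lemma source_fun_ge0 p x : 0 <= source_fun p x.
Proof. by rewrite /source_fun; case: ifP => // _; exact: powR_ge0. Qed.

Lemma le_source_fun p x y : 0 <= p -> 0 <= x -> x <= y -> y <= 1 ->
  source_fun p x <= source_fun p y.
Proof.
move=> p0; rewrite le_eqVlt => /orP[/eqP<- _ _|x0 xy y1].
  by rewrite source_fun0 source_fun_ge0.
have y0 := lt_le_trans x0 xy.
rewrite !source_funE//; apply: ler_powRN => //.
  by have := ln_le0 y1; lra.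
by rewrite lerD2l lerN2 ler_ln.
Qed.

Lemma source_fun_le1 p x : 0 <= p -> 0 <= x <= 1 -> source_fun p x <= 1.
Proof.
move=> p0 /andP[x0 x1]; apply: le_trans (le_source_fun p0 x0 x1 (lexx _)) _.
by rewrite source_funE// ln1 subr0 powR1.
Qed.

(** The first term dominates for [x <= d] because [F] is nondecreasing, the
    second one for [x > d]. *)
Lemma source_fun_interpolation p d x : 0 <= p -> 0 < d <= 1 -> 0 <= x <= 1 ->
  source_fun p x ^+ 2 <=
    source_fun p d ^+ 2 + (d ^+ 2)^-1 * (x * source_fun p x) ^+ 2.
Proof.
move=> p0 /andP[d0 d1] /andP[x0 x1]; have F0 := source_fun_ge0 p.
have [xd|dx] := leP x d.
  rewrite ler_wpDr ?mulr_ge0 ?sqr_ge0 ?invr_ge0 ?sqr_ge0//.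
  by rewrite lerXn2r ?nnegrE ?le_source_fun.
rewrite ler_wpDl ?sqr_ge0// exprMn mulrA ler_peMl ?sqr_ge0//.
rewrite mulrC ler_pdivlMr ?exprn_gt0// mul1r lerXn2r ?nnegrE// ltW//.
Qed.

Lemma powR_le_expR (q : R) : 0 <= q -> exists2 K, 1 <= K &
  forall t, 0 <= t -> t `^ q <= K * expR t.
Proof.
move=> q0; pose n := Num.truncn q.
have K1 : 1 <= (n.+1`!)%:R :> R by rewrite ler1n fact_gt0.
exists (n.+1`!)%:R => // t t0.
have e1 : 1 <= expR t by rewrite -expR0 ler_expR.
have [t1|/ltW t1] := leP t 1.
  apply: le_trans (_ : 1 <= _); last by rewrite -[leLHS]mulr1 ler_pM.
  apply: le_trans (_ : 1 `^ q <= _); last by rewrite powR1.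
  by apply: ge0_ler_powR; rewrite ?nnegrE.
apply: le_trans (_ : t ^+ n.+1 <= _).
  by rewrite -powR_mulrn//; apply: ler_powR => //; rewrite ltW ?truncnS_gt.
rewrite mulrC -ler_pdivrMr; last by rewrite ltr0n fact_gt0.
by apply: le_trans (expR_ge1Dxn n t0); rewrite lerDr.
Qed.

(** Put [N = n + 1] and [t = N * x]. As [(1 - x) ^+ n <= e * exp(- t)], the
    left-hand side is at most [N^-1 * e * t * exp(- t) * F(t / N)], and
    [F(t / N)] exceeds [F(1 / N) = (1 + ln N) ^ (- p)] by a factor at most
    [t ^ p] if [t >= 1], which the exponential absorbs. *)
Lemma source_fun_decay p : 0 <= p -> exists2 C, 0 <= C &
  forall n x, 0 <= x <= 1 ->
    x * (1 - x) ^+ n * source_fun p x <=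
      C / (n.+1%:R * (1 + ln n.+1%:R) `^ p).
Proof.
move=> p0; have [K K1 HK] := powR_le_expR (addr_ge0 p0 ler01).
have K0 : 0 <= K by apply: le_trans K1.
have E1 : 1 <= expR 1 :> R by rewrite -expR0 ler_expR.
exists (expR 1 * K) => [|n x]; first by rewrite mulr_ge0// expR_ge0.
set N : R := n.+1%:R.
have N0 : 0 < N by rewrite ltr0n.
have lN : 0 <= ln N by rewrite ln_ge0// ler1n.
have L0 : 0 < 1 + ln N by rewrite ltr_wpDr.
rewrite le_eqVlt => /andP[/orP[/eqP<- _|x0 x1]].
  by rewrite !mul0r divr_ge0// ?mulr_ge0 ?expR_ge0 ?powR_ge0// ltW.
have y1 : 0 <= (1 - x) ^+ n <= 1.
  by rewrite exprn_ge0 ?subr_ge0// exprn_ile1 ?subr_ge0// lerBlDr lerDl ltW.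
case/andP: y1 => y0 y1.
have -> : expR 1 * K / (N * (1 + ln N) `^ p) =
    N^-1 * (expR 1 * K) * (1 + ln N) `^ (- p).
  by rewrite powRN invfM; ring.
have [Nx1|Nx1] := leP (N * x) 1.
  have xN : x <= N^-1 by rewrite -div1r ler_pdivlMr// mulrC.
  have eK1 : 1 <= expR 1 * K by rewrite -[leLHS]mulr1 ler_pM.
  apply: ler_pM; rewrite ?mulr_ge0 ?source_fun_ge0 ?(ltW x0)//.
    by apply: ler_pM; rewrite ?(ltW x0)// (le_trans y1).
  apply: le_trans (le_source_fun p0 (ltW x0) xN _) _.
    by rewrite invf_le1// ler1n.
  by rewrite source_funE ?invr_gt0// lnV ?posrE// opprK.
pose t := N * x.
have t0 : 0 < t by rewrite mulr_gt0.
have xE : x = N^-1 * t by rewrite /t mulKf// gt_eqF.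
have lt0 : 0 <= ln t by rewrite ln_ge0// ltW.
have ltN : ln t <= ln N by rewrite ler_ln ?posrE// ler_piMr// ltW.
have ltt : 1 + ln t <= t.
  have h : - 1 < t - 1 by lra.
  by have := le_ln1Dx h; rewrite (addrC 1 (t - 1)) subrK; lra.
have FE : source_fun p x <= t `^ p * (1 + ln N) `^ (- p).
  rewrite source_funE// xE lnM ?posrE ?invr_gt0// lnV ?posrE//.
  apply: le_trans (_ : ((1 + ln t) * (1 + ln N)^-1) `^ p <= _); last first.
    rewrite powRM ?invr_ge0 ?(ltW L0) ?addr_ge0//.
    rewrite powRVN ?(ltW L0)// ler_wpM2r ?powR_ge0//.
    by apply: ge0_ler_powR; rewrite ?nnegrE ?addr_ge0// ltW.
  have M0 : 0 < 1 - (- ln N + ln t) by lra.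
  rewrite -powRVN ?(ltW M0)//.
  apply: ge0_ler_powR; rewrite ?nnegrE ?invr_ge0 ?(ltW M0)//.
    by rewrite mulr_ge0 ?invr_ge0 ?(ltW L0)// addr_ge0.
  rewrite -div1r ler_pdivrMr// mulrAC ler_pdivlMr// mul1r; nra.
have yE : (1 - x) ^+ n <= expR 1 * expR (- t).
  apply: le_trans (_ : expR (- x) ^+ n <= _).
    by rewrite lerXn2r ?nnegrE ?expR_ge0 ?subr_ge0// expR_ge1Dx.
  rewrite -expRM_natl -expRD ler_expR.
  by rewrite /t /N -natr1 mulrDl mul1r; lra.
apply: le_trans (_ : N^-1 * t * (expR 1 * expR (- t)) *
    (t `^ p * (1 + ln N) `^ (- p)) <= _).
  rewrite -xE ler_pM ?mulr_ge0 ?source_fun_ge0 ?(ltW x0)//.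
  by rewrite ler_wpM2l// ltW.
have -> : N^-1 * t * (expR 1 * expR (- t)) * (t `^ p * (1 + ln N) `^ (- p)) =
    N^-1 * (expR 1 * (t `^ (p + 1) * expR (- t))) * (1 + ln N) `^ (- p).
  rewrite powRD; last by rewrite (gt_eqF t0) implybT.
  by rewrite powRr1 ?(ltW t0)//; ring.
rewrite ler_wpM2r ?powR_ge0// ler_wpM2l ?invr_ge0 ?(ltW N0)//.
rewrite ler_wpM2l ?expR_ge0// expRN ler_pdivrMr ?expR_gt0//.
exact/HK/ltW.
Qed.

End source_function.

(** * Convergence rates of the fixed point iteration *)

Section fixed_point_iteration.
Context {R : realType} {V : lmodType R} (B : V -> V -> R) (T : V -> V).
Context (B_inner : semi_inner B).
Context (B_def : forall u, B u u = 0 -> u = 0).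
Context (T_sym : forall u v, B (T u) v = B u (T v)).
Context (T_ge0 : forall u, 0 <= B (T u) u).
Local Notation nrm := (inner_norm B).
Context (T_nonexp : forall u, nrm (T u) <= nrm u).
Local Notation S := (fun u => u - T u).

(** Iterations are counted from 0, so that [fp_iter phi1 z n] is the iterate of
    index [n + 1] in the convention where [phi1] has index 1. *)
Definition fp_iter (phi1 z : V) n := iter n (fun u => T u + z) phi1.
Definition fp_residual phi1 z n :=
  nrm (z - (fp_iter phi1 z n - T (fp_iter phi1 z n))).

Let T_linear := symmetric_linear B_inner B_def T_sym.

Let TB u v : T (u - v) = T u - T v.
Proof.
by have := T_linear (- 1) v u; rewrite !scaleN1r addrC => ->; rewrite addrC.
Qed.

Let TD u v : T (u + v) = T u + T v.
Proof. by have := T_linear 1 u v; rewrite !scale1r. Qed.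

Lemma onem_linear c u v : S (c *: u + v) = c *: S u + S v.
Proof. by rewrite /= T_linear scalerBr opprD addrACA. Qed.

Lemma onem_sym u v : B (S u) v = B u (S v).
Proof. by rewrite /= (innerBl B_inner) (innerBr B_inner) T_sym. Qed.

Lemma onem_ge0 u : 0 <= B (S u) u.
Proof.
rewrite /= (innerBl B_inner) subr_ge0.
apply: le_trans (inner_le_norm B_inner _ _) _.
by rewrite -(inner_norm_sqr B_inner) expr2 ler_wpM2r ?inner_norm_ge0.
Qed.

Lemma onem_le1 u : B (S u) u <= B u u.
Proof. by rewrite /= (innerBl B_inner) lerBlDr lerDl. Qed.

Let poly_opTn n v : poly_op S ((1 - 'X) ^+ n) v = iter n T v.
Proof.
rewrite (poly_op_onemXn onem_linear).
by congr iter; apply/funext => u; rewrite subKr.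
Qed.

Lemma iterT_nonexp n u : nrm (iter n T u) <= nrm u.
Proof. by elim: n => //= n; exact: le_trans. Qed.

Lemma iterTB n u v : iter n T (u - v) = iter n T u - iter n T v.
Proof. by elim: n => //= n ->. Qed.

Lemma iterTD n u v : iter n T (u + v) = iter n T u + iter n T v.
Proof. by elim: n => //= n ->. Qed.

Context (phibar phi1 z : V).
Context (phibar_fixed : T phibar + z = phibar).
Let w := phibar - phi1.


(** One step adds its residual [r] to the iterate, so that the next residual is
    [r - S r = T r]. *)
Lemma fp_residualE z' n :
  fp_residual phi1 z' n = nrm (iter n T (z' - z) + iter n T (S w)).
Proof.
have S_phibar : phibar - T phibar = z by rewrite -{1}phibar_fixed addrC addKr.
rewrite /fp_residual -iterTD; congr (nrm _).
elim: n => [|n IH].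
  have -> : S w = z - (phi1 - T phi1).
    by rewrite /= -S_phibar TB !opprB addrACA [RHS]addrACA (addrC (- phi1)).
  by rewrite /= addrA subrK.
set u := fp_iter phi1 z' n in IH *.
set r := z' - (u - T u) in IH.
have -> : fp_iter phi1 z' n.+1 = u + r.
  by rewrite /r opprB addrCA subrKC addrC.
by rewrite iterS -IH TD (opprD (T u)) (addrACA u) opprD addrA -/r subKr.
Qed.

(** Each step adds a perturbation [z - z'] to the error, which [T] does not
    increase later on. *)
Lemma fp_error_le z' n (d : R) : nrm (z' - z) <= d ->
  nrm (phibar - fp_iter phi1 z' n) <= nrm (iter n T w) + n%:R * d.
Proof.
move=> zd.
apply: le_trans (_ : _ <= nrm (iter n T w) +
    nrm (phibar - fp_iter phi1 z' n - iter n T w)) _.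
  by rewrite -[X in nrm X <= _](subrKC (iter n T w)) (inner_normD B_inner).
rewrite lerD2l; elim: n => [|n IH].
  by rewrite /= /fp_iter/= subrr (inner_norm0 B_inner) mul0r.
set u := fp_iter phi1 z' n in IH *.
have -> : phibar - fp_iter phi1 z' n.+1 - iter n.+1 T w =
    T (phibar - u - iter n T w) - (z' - z).
  rewrite (_ : fp_iter _ _ _ = T u + z')// -{1}phibar_fixed !TB.
  by rewrite opprD addrACA [LHS]addrAC (opprB z').
apply: le_trans (inner_normD B_inner _ _) _.
rewrite (inner_norm_opp B_inner) -natr1 mulrDl mul1r lerD//.
exact: le_trans IH.
Qed.


Context (psi : V) (p : R).
Context (p_gt0 : 0 < p).
Context (source : continuous_calculus nrm (source_fun p) S psi w).

Let calc_bound :=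
  calculus_poly_bound B_inner onem_linear onem_sym onem_ge0 onem_le1.
Let calc_interp :=
  calculus_interpolation B_inner onem_linear onem_sym onem_ge0 onem_le1.
Let calc_poly :=
  calculus_poly_op B_inner onem_linear onem_sym onem_ge0 onem_le1.

Let iterT_S n u : iter n T (S u) = S (iter n T u).
Proof. by rewrite /= iterTB -iterS -iterSr. Qed.

Lemma noise_free_residual_decay : exists2 C, 0 <= C &
  forall n, nrm (iter n T (S w)) <= C / (n.+1%:R * (1 + ln n.+1%:R) `^ p).
Proof.
have [C C0 HC] := @source_fun_decay R p (ltW p_gt0).
exists (C * nrm psi); first by rewrite mulr_ge0 ?inner_norm_ge0.
move=> n; rewrite mulrAC.
have -> : iter n T (S w) = poly_op S ('X * (1 - 'X) ^+ n) w.
  by rewrite mulrC poly_opM ?poly_opX ?poly_opTn//; exact: onem_linear.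
apply: (calc_bound _ source) => [|x x01].
  rewrite divr_ge0// mulr_ge0// powR_ge0//.
have /andP[x0 x1] := x01.
rewrite hornerM horner_exp hornerD hornerN hornerX hornerC ger0_norm ?HC//.
by rewrite !mulr_ge0 ?exprn_ge0 ?subr_ge0 ?source_fun_ge0.
Qed.

(** Applied to [T^n w = F(S) (T^n psi)], whose source [T^n psi] is no larger
    than [psi]. *)
Lemma conditional_stability n d : 0 < d <= 1 ->
  nrm (iter n T w) <= source_fun p d * nrm psi + d^-1 * nrm (iter n T (S w)).
Proof.
move=> d01; have /andP[d0 d1] := d01.
have F0 := source_fun_ge0 p d.
have := calc_poly ((1 - 'X) ^+ n) source; rewrite !poly_opTn => calc_n.
have := calc_interp _ _ calc_n.
move=> /(_ (source_fun p d ^+ 2) (d ^+ 2)^-1).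
rewrite sqr_ge0 invr_ge0 sqr_ge0 => /(_ isT isT) H.
have {}H : nrm (iter n T w) ^+ 2 <= source_fun p d ^+ 2 * nrm psi ^+ 2 +
    (d ^+ 2)^-1 * nrm (S (iter n T w)) ^+ 2.
  apply: le_trans (H _ _) _ => [x x01|x x01|].
  - by rewrite ger0_norm ?source_fun_ge0// source_fun_le1// ltW.
  - by apply: source_fun_interpolation => //; exact: ltW.
  rewrite lerD2r ler_wpM2l ?sqr_ge0// lerXn2r ?nnegrE ?inner_norm_ge0//.
  exact: iterT_nonexp.
have a0 : 0 <= source_fun p d * nrm psi by rewrite mulr_ge0 ?inner_norm_ge0.
have b0 : 0 <= d^-1 * nrm (iter n T (S w)).
  by rewrite mulr_ge0 ?invr_ge0 ?inner_norm_ge0// ltW.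
rewrite -(@ler_pXn2r _ 2)// ?nnegrE ?inner_norm_ge0 ?addr_ge0//.
apply: le_trans H _.
rewrite -iterT_S -exprVn -!exprMn sqrrD lerD2r lerDl.
by rewrite mulrn_wge0// mulr_ge0.
Qed.

Context (mu : R) (zeps : R -> V).
Context (mu_gt1 : 1 < mu).
Context (noise : forall eps, 0 < eps -> nrm (zeps eps - z) <= eps).

Let residual_dist eps n : 0 < eps ->
  `|fp_residual phi1 (zeps eps) n - nrm (iter n T (S w))| <= eps.
Proof.
move=> e0; rewrite fp_residualE.
apply: le_trans (inner_norm_dist B_inner _ _) _; rewrite addrK.
exact: le_trans (iterT_nonexp _ _) (noise e0).
Qed.

Lemma discrepancy_stops eps : 0 < eps -> exists2 n,
  fp_residual phi1 (zeps eps) n <= mu * eps &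
  forall j, (j < n)%N -> mu * eps < fp_residual phi1 (zeps eps) j.
Proof.
move=> e0; have [C C0 HC] := noise_free_residual_decay.
have ex : exists n, fp_residual phi1 (zeps eps) n <= mu * eps.
  have m0 : 0 < (mu - 1) * eps by rewrite mulr_gt0// subr_gt0.
  pose n := Num.truncn (C / ((mu - 1) * eps)).
  exists n; have := residual_dist n e0; rewrite ler_norml => /andP[_].
  suff : nrm (iter n T (S w)) <= (mu - 1) * eps by lra.
  apply: le_trans (HC n) _.
  have n1 : 1 <= n.+1%:R :> R by rewrite ler1n.
  have l1 : 1 <= (1 + ln n.+1%:R) `^ p.
    apply: le_trans (_ : 1 `^ p <= _); first by rewrite powR1.
    apply: ge0_ler_powR; rewrite ?nnegrE ?addr_ge0 ?ln_ge0 ?(ltW p_gt0)//.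
    by rewrite lerDl ln_ge0.
  rewrite ler_pdivrMr; last by rewrite mulr_gt0 ?(lt_le_trans ltr01 l1).
  rewrite mulrC -ler_pdivrMr//; apply: ltW.
  apply: lt_le_trans (truncnS_gt _) _; rewrite -/n ler_peMr//.
case: (ex_minnP ex) => n nP nmin; exists n => // j jn.
by rewrite ltNge; apply/negP => /nmin; rewrite leqNgt jn.
Qed.

(** An index that does not satisfy the stopping test has a noise-free residual
    larger than [(mu - 1) * eps], to be compared with the decay of the
    noise-free residuals. *)
Lemma discrepancy_index_bound : exists2 C, 0 <= C & forall eps n, 0 < eps ->
  mu * eps < fp_residual phi1 (zeps eps) n ->
  n.+1%:R * (1 + ln n.+1%:R) `^ p <= C / eps.
Proof.
have [C C0 HC] := noise_free_residual_decay.
have m0 : 0 < mu - 1 by rewrite subr_gt0.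
exists (C / (mu - 1)); first by rewrite divr_ge0// ltW.
move=> eps n e0 res.
have D0 : 0 < n.+1%:R * (1 + ln n.+1%:R) `^ p :> R.
  by rewrite mulr_gt0// powR_gt0// ltr_wpDr// ln_ge0// ler1n.
have : (mu - 1) * eps < C / (n.+1%:R * (1 + ln n.+1%:R) `^ p).
  apply: lt_le_trans (HC n).
  by have := residual_dist n e0; rewrite ler_norml => /andP[_]; lra.
rewrite ltr_pdivlMr// => /ltW H.
by rewrite ler_pdivlMr// ler_pdivlMr//; lra.
Qed.

(** Here [n + 1] is the stopping index. The previous bound applies to [n - 1],
    and going from [n] to [n + 1] costs a factor 2, as
    [n + 1 <= 2 n] and [ln (n + 1) <= 1 + ln n]. *)
Lemma stopping_index_rate : exists2 C, 0 < C & forall eps n, 0 < eps ->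
  (forall j, (j < n)%N -> mu * eps < fp_residual phi1 (zeps eps) j) ->
  n.+1%:R * ln n.+1%:R `^ p <= C / eps.
Proof.
have [C C0 HC] := discrepancy_index_bound.
exists (2 * C + 1); first by rewrite ltr_wpDl// mulr_ge0.
move=> eps [|n] e0 res.
  by rewrite ln1 powR0 ?gt_eqF// mulr0 divr_ge0 ?addr_ge0 ?mulr_ge0// ltW.
have {res} H := HC _ _ e0 (res n (ltnSn n)).
apply: le_trans (_ : 2 * C / eps <= _); last first.
  by rewrite ler_pM2r ?invr_gt0// lerDl.
rewrite -mulrA; apply: le_trans (_ : 2 * (n.+1%:R * (1 + ln n.+1%:R) `^ p) <= _).
  rewrite mulrA; apply: ler_pM; rewrite ?powR_ge0//.
    by rewrite -natrM ler_nat; lia.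
  apply: ge0_ler_powR; rewrite ?nnegrE ?(ltW p_gt0)// ?addr_ge0 ?ln_ge0 ?ler1n//.
  rewrite -[X in _ <= X + _]expRK -lnM ?posrE ?expR_gt0//.
  rewrite ler_ln ?posrE ?mulr_gt0 ?expR_gt0//.
  have e2 : 2 <= expR 1 :> R by have := @expR_ge1Dx R 1; lra.
  apply: le_trans (_ : 2 * n.+1%:R <= _); last by rewrite ler_pM2r.
  by rewrite -natrM ler_nat; lia.
by rewrite ler_wpM2l.
Qed.

Lemma logarithmic_rate : exists2 C, 0 < C & forall eps n, 0 < eps < 1 ->
  fp_residual phi1 (zeps eps) n <= mu * eps ->
  (forall j, (j < n)%N -> mu * eps < fp_residual phi1 (zeps eps) j) ->
  nrm (phibar - fp_iter phi1 (zeps eps) n) <= C * (- ln (Num.sqrt eps)) `^ (- p).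
Proof.
have [C C0 HC] := discrepancy_index_bound.
have [K K1 HK] := powR_le_expR (ltW p_gt0).
have K0 : 0 <= K by apply: le_trans K1.
have m1 : 0 <= mu + 1 by rewrite addr_ge0// ltW// (lt_trans ltr01).
exists (nrm psi + (mu + 1) * K + C + K).
  rewrite ltr_wpDl ?(lt_le_trans ltr01 K1)// !addr_ge0 ?inner_norm_ge0//.
  by rewrite mulr_ge0.
move=> eps n /andP[e0 e1] res_n res_j.
set d := Num.sqrt eps; set s := - ln d.
have d0 : 0 < d by rewrite sqrtr_gt0.
have d1 : d < 1 by rewrite -sqrtr1 ltr_sqrt.
have dd : d * d = eps by rewrite -expr2 sqr_sqrtr// ltW.
have s0 : 0 < s by rewrite oppr_gt0 ln_lt0// d0.
have sp0 : 0 < s `^ p by rewrite powR_gt0.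
have dK : d <= K * s `^ (- p).
  have -> : d = (expR s)^-1 by rewrite -expRN opprK lnK.
  rewrite powRN ler_pdivlMr// mulrC ler_pdivrMr ?expR_gt0//.
  exact/HK/ltW.
have Fd : source_fun p d <= s `^ (- p).
  by rewrite source_funE// ler_powRN ?(ltW p_gt0)// -/s; lra.
have ne : n%:R * eps <= (C + K) * s `^ (- p).
  have P0 := powR_ge0 s (- p).
  case: n res_j {res_n} => [|n] res_j; first by rewrite mul0r mulr_ge0// addr_ge0.
  have {res_j} H := HC _ _ e0 (res_j n (ltnSn n)).
  rewrite mulrDl.
  (* below 1 / sqrt eps the index itself is small enough; above, its logarithm
     is at least s *)
  have [nd|nd] := leP (n.+1%:R * d) 1.
    rewrite -dd mulrA; apply: le_trans (_ : d <= _).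
      by rewrite ler_piMl// ltW.
    by apply: le_trans dK _; rewrite lerDr mulr_ge0.
  rewrite -[leLHS]addr0 lerD ?mulr_ge0//.
  rewrite powRN ler_pdivlMr// mulrAC -ler_pdivlMr//.
  apply: le_trans H; rewrite ler_wpM2l//.
  apply: ge0_ler_powR; rewrite ?nnegrE ?(ltW p_gt0) ?(ltW s0)//.
    by rewrite addr_ge0// ln_ge0// ler1n.
  have : 0 < ln (n.+1%:R * d) by rewrite ln_gt0.
  by rewrite lnM ?posrE// /s; lra.
apply: le_trans (fp_error_le _ (noise e0)) _.
rewrite -addrA mulrDl lerD//.
apply: le_trans (@conditional_stability n d _) _; first by rewrite d0 ltW.
rewrite mulrDl lerD//; first by rewrite mulrC ler_wpM2l ?inner_norm_ge0.
have Sw : nrm (iter n T (S w)) <= (mu + 1) * eps.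
  by have := residual_dist n e0; rewrite ler_norml => /andP[+ _]; lra.
rewrite mulrC ler_pdivrMr//; apply: le_trans Sw _.
by rewrite -dd mulrA ler_wpM2r ?(ltW d0)// -mulrA ler_wpM2l.
Qed.

End fixed_point_iteration.

(** * Measurability and boundedness in the plane *)

Section plane_measurability.
Context {R : realType}.

(** The measurable sets of the plane are generated by rectangles, and an open
    set is the union of the countably many rectangles with rational vertices
    that it contains. *)
Lemma open_measurable_plane (O : set (R * R)) : open O -> measurable O.
Proof.
move=> oO.
pose box (q : (rat * rat) * (rat * rat)) : set (R * R) :=
  `]ratr q.1.1, ratr q.1.2[%classic `*` `]ratr q.2.1, ratr q.2.2[%classic.
pose F q := if pselect (box q `<=` O) then box q else set0.
rewrite (_ : O = \bigcup_q F q).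
  apply: countable_bigcupT_measurable => [|q]; first exact: countableP.
  rewrite /F; case: pselect => [qO|qO] /=; last exact: measurable0.
  by apply: measurableX; exact: measurable_itv.
apply/seteqP; split=> [x Ox|x [q _]]; last first.
  by rewrite /F; case: pselect => //= qO xq; exact: qO.
have : nbhs x O by move: oO; rewrite openE; exact.
rewrite -nbhs_ballE => -[e /= e0 eO].
have rat_between (y : R) : exists q : rat * rat,
    [/\ y - e < ratr q.1, ratr q.1 < y, y < ratr q.2 & ratr q.2 < y + e].
  have [|q1] := @rat_in_itvoo R (y - e) y; first lra.
  have [|q2] := @rat_in_itvoo R y (y + e); first lra.
  rewrite !in_itv/= => /andP[? ?] /andP[? ?].
  by exists (q1, q2).
have [q1 [a1 a2 a3 a4]] := rat_between x.1.
have [q2 [b1 b2 b3 b4]] := rat_between x.2.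
exists (q1, q2) => //; rewrite /F; case: pselect => [qO /=|]; last first.
  case=> y [/=]; rewrite !in_itv/= => /andP[? ?] /andP[? ?].
  by apply: eO; split; rewrite /ball/= ltr_norml; apply/andP; split; lra.
by split; rewrite /= in_itv/=; apply/andP.
Qed.

Lemma continuous_measurable_plane (D : set (R * R)) (h : R * R -> R) :
  measurable D -> continuous h -> measurable_fun D h.
Proof.
move=> mD /continuousP ch.
apply: (measurability _ (RGenOpens.measurableE R)) => _ [_ [a [b ->] <-]].
apply: measurableI => //; apply: open_measurable_plane; apply: ch.
exact: interval_open.
Qed.

Lemma bounded_plane_box (A : set (R * R)) : bounded_set A -> exists2 M, 0 <= M &
  A `<=` `[- M, M]%classic `*` `[- M, M]%classic.
Proof.
move=> [M [_ AM]]; exists (`|M| + 1); first by rewrite addr_ge0.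
move=> x Ax; have := AM (`|M| + 1).
rewrite ltr_pwDr ?ler_norm// => /(_ isT x Ax).
rewrite /= prod_normE ge_max !ler_norml => /andP[/andP[? ?] /andP[? ?]].
by split; rewrite /= in_itv/=; apply/andP.
Qed.

Lemma continuous_bounded_on (A : set (R * R)) (h : R * R -> R) :
  bounded_set A -> continuous h -> exists2 C, 0 <= C & forall x, A x -> `|h x| <= C.
Proof.
move=> /bounded_plane_box[M M0 AM] ch.
have /compact_bounded[C [_ HC]] :
    compact (h @` (`[- M, M]%classic `*` `[- M, M]%classic)).
  apply: continuous_compact; first exact: continuous_subspaceT.
  by apply: compact_setX; exact: segment_compact.
exists (`|C| + 1); first by rewrite addr_ge0.
by move=> x /AM xM; apply: (HC (`|C| + 1)); [rewrite ltr_pwDr ?ler_norm|exists x].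
Qed.

Lemma bounded_finite_plane (A : set (R * R)) : measurable A -> bounded_set A ->
  (((@lebesgue_measure R) \x (@lebesgue_measure R))%E A < +oo)%E.
Proof.
move=> mA /bounded_plane_box[M M0 AM].
set mu2 := (X in (X A < _)%E).
apply: (@le_lt_trans _ _ (mu2 (`[- M, M]%classic `*` `[- M, M]%classic))).
  by apply: le_measure; rewrite ?inE//; apply: measurableX; exact: measurable_itv.
have fin : (@lebesgue_measure R `[(- M)%R, M]%classic < +oo)%E.
  by rewrite lebesgue_measure_itv/=; case: ifP => _; rewrite ?ltry// -EFinB ltry.
rewrite /mu2 product_measure1E//; apply: lte_mul_pinfty => //.
by rewrite ge0_fin_numE.
Qed.

End plane_measurability.

(** * Square integrable functions *)

Section square_integrable.
Context d {T : measurableType d} {R : realType} (mu : {measure set T -> \bar R}).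
Context (D : set T) (mD : measurable D).
Implicit Types f g h : T -> R.

(** The class [L2] of the plane, over an arbitrary measure space. *)
Definition square_integrable f :=
  measurable_fun D f /\ (\int[mu]_(x in D) ((f x) ^+ 2)%:E < +oo)%E.

Local Notation integ f := (mu.-integrable D (EFin \o f)).

Lemma integrable_lin (c : R) f g : integ f -> integ g ->
  integ (fun x => c * f x + g x).
Proof.
move=> If Ig; have -> : (EFin \o (fun x => c * f x + g x)) =
    ((fun x => c%:E * (EFin \o f) x) \+ (EFin \o g))%E.
  by apply/funext => x /=; rewrite EFinD EFinM.
by apply: integrableD => //; apply: integrableZl.
Qed.

Lemma integrable_fin_sum (I : finType) (F : I -> T -> R) :
  (forall i, integ (F i)) -> integ (fun x => \sum_i F i x).
Proof.
move=> IF; have -> : (EFin \o (fun x => \sum_i F i x)) =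
    (fun x => \sum_i (F i x)%:E)%E by apply/funext => x /=; rewrite -sumEFin.
by apply: integrable_sum => // i _; exact: IF.
Qed.

Lemma Rintegral_lin (c : R) f g : integ f -> integ g ->
  \int[mu]_(x in D) (c * f x + g x) =
  c * \int[mu]_(x in D) f x + \int[mu]_(x in D) g x.
Proof.
move=> If Ig; rewrite RintegralD ?RintegralZl//.
have := integrable_lin c If (integrable0 mu D).
by apply: eq_integrable => // x _; rewrite /= addr0.
Qed.

Lemma square_integrableP f : square_integrable f <->
  measurable_fun D f /\ integ (fun x => f x ^+ 2).
Proof.
split=> -[mf].
  move=> If; split=> //; apply/integrableP; split.
    by apply/measurable_EFinP; exact: measurable_funX.
  by under eq_integral do rewrite /= ger0_norm ?sqr_ge0//.
move=> /integrableP[_]; under eq_integral do rewrite /= ger0_norm ?sqr_ge0//.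
by split.
Qed.

Lemma integrable_dominated f g : measurable_fun D f -> integ g ->
  (forall x, D x -> `|f x| <= g x) -> integ f.
Proof.
move=> mf Ig fg; apply: le_integrable Ig => //; first exact/measurable_EFinP.
by move=> x Dx /=; rewrite lee_fin (le_trans (fg x Dx))// ler_norm.
Qed.

Lemma integrable_mul f g : square_integrable f -> square_integrable g ->
  integ (fun x => f x * g x).
Proof.
move=> /square_integrableP[mf If] /square_integrableP[mg Ig].
apply: (@integrable_dominated _ (fun x => 1 * f x ^+ 2 + g x ^+ 2)).
- exact: measurable_funM.
- exact: integrable_lin.
- move=> x _; rewrite ler_norml mul1r; move: (f x) (g x) => a b.
  by apply/andP; split; nra.
Qed.

Lemma square_integrable_lin (c : R) f g :
  square_integrable f -> square_integrable g ->
  square_integrable (fun x => c * f x + g x).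
Proof.
move=> Hf Hg; have [[mf If] [mg Ig]] :=
  (iffLR (square_integrableP _) Hf, iffLR (square_integrableP _) Hg).
apply/square_integrableP; split.
  by apply: measurable_funD => //; apply: measurable_funM.
have := integrable_lin (c ^+ 2) If
  (integrable_lin (2 * c) (integrable_mul Hf Hg) Ig).
by apply: eq_integrable => // x _ /=; congr EFin; ring.
Qed.

Lemma square_integrable_bounded f (C : R) : (mu D < +oo)%E -> measurable_fun D f ->
  (forall x, D x -> `|f x| <= C) -> square_integrable f.
Proof.
move=> Doo mf fC; apply/square_integrableP; split=> //.
apply: (@integrable_dominated _ (cst (C ^+ 2))); first exact: measurable_funX.
  apply/integrableP; split; first exact/measurable_EFinP/measurable_cst.
  by rewrite /= integral_cst// lte_mul_pinfty.
move=> x Dx; rewrite normrX lerXn2r ?nnegrE ?fC//.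
by rewrite (le_trans _ (fC x Dx)).
Qed.

(** For the coefficients of the operator, which are only essentially bounded. *)
Lemma integrable_ae_bounded_mul f g (M : R) : measurable_fun D f ->
  {ae mu, forall x, D x -> `|f x| <= M} -> integ g ->
  integ (fun x => f x * g x).
Proof.
move=> mf fM Ig; have mg : measurable_fun D g.
  by apply/measurable_EFinP; case/integrableP: Ig.
apply/integrableP; split.
  by apply/measurable_EFinP; exact: measurable_funM.
have /integrableP[_] := integrable_lin `|M| Ig (integrable0 mu D).
apply: le_lt_trans; apply: ae_ge0_le_integral => //.
- by apply/measurable_EFinP; apply: measurableT_comp => //; exact: measurable_funM.
- apply/measurable_EFinP; apply: measurableT_comp => //.
  by apply: measurable_funD => //; apply: measurable_funM.
- apply: filterS fM => x fM Dx /=; rewrite lee_fin addr0 !normrM ler_wpM2r//.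
  by rewrite normr_id (le_trans (fM Dx))// ler_norm.
Qed.

Lemma ae_imply (P Q : T -> Prop) : (forall x, P x -> Q x) ->
  {ae mu, forall x, P x} -> {ae mu, forall x, Q x}.
Proof. by move=> PQ; apply: filterS. Qed.

Lemma Rintegral_ae_eq f g : measurable_fun D f -> measurable_fun D g ->
  {ae mu, forall x, D x -> f x = g x} ->
  \int[mu]_(x in D) f x = \int[mu]_(x in D) g x.
Proof.
move=> mf mg fg; congr fine.
apply: ae_eq_integral => //; try exact/measurable_EFinP.
by apply: filterS fg => x fg Dx; rewrite fg.
Qed.

Lemma Rintegral_ae_ge0 f : integ f -> {ae mu, forall x, D x -> 0 <= f x} ->
  0 <= \int[mu]_(x in D) f x.
Proof.
move=> If f0; have mf : measurable_fun D f.
  by apply/measurable_EFinP; case/integrableP: If.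
rewrite (@Rintegral_ae_eq f (fun x => `|f x|)) ?Rintegral_ge0//.
  exact: measurableT_comp.
by apply: filterS f0 => x f0 Dx; rewrite ger0_norm// f0.
Qed.

Lemma Rintegral_ge0_eq0 f : integ f -> (forall x, D x -> 0 <= f x) ->
  \int[mu]_(x in D) f x = 0 -> {ae mu, forall x, D x -> f x = 0}.
Proof.
move=> If f0 f_eq0; have [mf _] := integrableP _ _ _ If.
have : (\int[mu]_(x in D) `|(f x)%:E| = 0)%E.
  under eq_integral => x /set_mem Dx do rewrite /= ger0_norm ?f0//.
  have := integrable_fin_num mD If => /fineK <-.
  by rewrite -[fine _]/(\int[mu]_(x in D) f x) f_eq0.
move=> /(ae_eq_integral_abs mu mD mf); apply: filterS => x H Dx.
by have [] := H Dx.
Qed.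

End square_integrable.

(** * Smooth functions *)

Section smooth_functions.
Context {R : realType}.
Implicit Types h k : R * R -> R.

Lemma partial_lin i (c : R) h k :
  (forall x, derivable h x (basis_vec i)) ->
  (forall x, derivable k x (basis_vec i)) ->
  partial i (c *: h + k) = c *: partial i h + partial i k.
Proof.
move=> dh dk; apply/funext => x; rewrite /partial deriveD//; last exact: derivableZ.
by rewrite deriveZ.
Qed.

Lemma iter_partial_lin s (c : R) h k : smooth h -> smooth k ->
  iter_partial s (c *: h + k) = c *: iter_partial s h + iter_partial s k.
Proof.
move=> sh sk; elim: s => //= i s ->; apply: partial_lin => x.
  by have [_] := sh s; exact.
by have [_] := sk s; exact.
Qed.

Lemma smooth_lin (c : R) h k : smooth h -> smooth k -> smooth (c *: h + k).
Proof.
move=> sh sk s; rewrite iter_partial_lin//.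
have [ch dh] := sh s; have [ck dk] := sk s; split=> [x|i x].
  by apply: cvgD; [apply: cvgZr; exact: ch|exact: ck].
by apply: derivableD => //; exact: derivableZ.
Qed.

Lemma iter_partial0 s : iter_partial s (0 : R * R -> R) = 0.
Proof.
elim: s => //= i s ->; apply/funext => x.
by rewrite /partial derive_cst.
Qed.

Lemma smooth0 : smooth (0 : R * R -> R).
Proof.
move=> s; rewrite iter_partial0; split=> [x|i x]; first exact: cst_continuous.
exact: derivable_cst.
Qed.

Lemma smooth_continuous h : smooth h -> continuous h.
Proof. by move=> /(_ [::])[]. Qed.

Lemma smooth_partial_continuous i h : smooth h -> continuous (partial i h).
Proof. by move=> /(_ [:: i])[]. Qed.

Lemma jet_of_lin (c : R) h k : smooth h -> smooth k ->
  jet_of (c *: h + k) = c *: jet_of h + jet_of k.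
Proof.
move=> sh sk; congr pair; apply/funext => i.
by have := iter_partial_lin [:: i] c sh sk.
Qed.

Lemma jet_of0 : jet_of (0 : R * R -> R) = 0.
Proof. by congr pair; apply/funext => i; have := iter_partial0 [:: i]. Qed.

End smooth_functions.

(** * The space H1 and its functions of zero trace *)

Section energy_space.
Context {R : realType} (Omega : set (R * R)).
Context (Omega_open : open Omega).
Context (Omega_bounded : bounded_set Omega).
Local Notation plane := (R * R)%type.
Local Notation jet := ((plane -> R) * ('I_2 -> plane -> R))%type.
Local Notation mu2 := ((@lebesgue_measure R) \x (@lebesgue_measure R))%E.
Local Notation integ f := (mu2.-integrable Omega (EFin \o f)).
Implicit Types (u v w : jet) (h k : plane -> R).

Let mO : measurable Omega := open_measurable_plane Omega_open.
Let finO : (mu2 Omega < +oo)%E := bounded_finite_plane mO Omega_bounded.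

Let Ilin := @integrable_lin _ _ R mu2 Omega mO.
Let Isum := @integrable_fin_sum _ _ R mu2 Omega mO.
Let RIlin := @Rintegral_lin _ _ R mu2 Omega mO.

Let IZ (c : R) h : integ h -> integ (fun x => c * h x).
Proof.
move=> Ih; have := Ilin c Ih (integrable0 mu2 Omega).
by apply: eq_integrable => // x _; rewrite /= addr0.
Qed.

Definition L2_jet u := L2 Omega u.1 /\ forall i, L2 Omega (grad u i).

Lemma L2_lin (c : R) h k : L2 Omega h -> L2 Omega k ->
  L2 Omega (fun x => c * h x + k x).
Proof. exact: (@square_integrable_lin _ _ _ mu2 Omega mO c h k). Qed.

Lemma L2_continuous h : continuous h -> L2 Omega h.
Proof.
move=> ch; have [C _ hC] := continuous_bounded_on Omega_bounded ch.
apply: (@square_integrable_bounded _ _ _ mu2 Omega mO h C) => //.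
exact: continuous_measurable_plane.
Qed.

Lemma integrable_L2M h k : L2 Omega h -> L2 Omega k -> integ (fun x => h x * k x).
Proof. exact: (@integrable_mul _ _ _ mu2 Omega mO h k). Qed.

Lemma L2_jet_lin (c : R) u v : L2_jet u -> L2_jet v -> L2_jet (c *: u + v).
Proof.
move=> [u0 u1] [v0 v1]; split; first exact: (L2_lin c u0 v0).
by move=> i; exact: (L2_lin c (u1 i) (v1 i)).
Qed.

Lemma H1_L2_jet u : H1 Omega u -> L2_jet u.
Proof. by move=> [u0 u1 _]; split. Qed.

Lemma L2_jet_of h : smooth h -> L2_jet (jet_of h).
Proof.
move=> sh; split=> [|i]; apply: L2_continuous; first exact: smooth_continuous.
exact: smooth_partial_continuous.
Qed.

Lemma L2_jetB u v : L2_jet u -> L2_jet v -> L2_jet (u - v).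
Proof. by move=> Hu Hv; rewrite addrC -scaleN1r; exact: L2_jet_lin. Qed.

Lemma L2_jet0 : L2_jet 0.
Proof. by rewrite -(@jet_of0 R); apply: L2_jet_of; exact: smooth0. Qed.

(** The weak derivatives are linear because test functions and their partial
    derivatives, being continuous, are square integrable on the bounded set
    [Omega]: all the integrals involved converge. *)
Lemma H1_lin (c : R) u v : H1 Omega u -> H1 Omega v -> H1 Omega (c *: u + v).
Proof.
move=> Hu Hv; have [H0 Hi] := L2_jet_lin c (H1_L2_jet Hu) (H1_L2_jet Hv).
split=> // h i th; have [sh _] := th.
have [u0 u1 uw] := Hu; have [v0 v1 vw] := Hv.
have Lh := L2_continuous (smooth_continuous sh).
have Lph := L2_continuous (smooth_partial_continuous (i := i) sh).
transitivity (\int[mu2]_(x in Omega)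
    (c * (u.1 x * partial i h x) + v.1 x * partial i h x)).
  by apply: eq_Rintegral => x _; rewrite /= mulrDl mulrA.
rewrite RIlin//; try exact: integrable_L2M.
rewrite uw// vw// mulrN -opprD -RIlin//; try exact: integrable_L2M.
by congr (- _); apply: eq_Rintegral => x _; rewrite mulrA -mulrDl.
Qed.

Lemma H1_0 : H1 Omega (0 : jet).
Proof.
have [H0 Hi] := L2_jet0; split=> // h i _.
rewrite [LHS](_ : _ = 0); last first.
  under eq_Rintegral do rewrite /= mul0r.
  by rewrite Rintegral_cst// mul0r.
under eq_Rintegral do rewrite /grad/= mul0r.
by rewrite Rintegral_cst// mul0r oppr0.
Qed.

Definition jet_sqr u x := u.1 x ^+ 2 + \sum_(i < 2) grad u i x ^+ 2.

Lemma integrable_jet_sqr u : L2_jet u -> integ (jet_sqr u).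
Proof.
move=> [u0 ui].
have := Ilin 1 (integrable_L2M u0 u0)
  (Isum (fun i => integrable_L2M (ui i) (ui i))).
by apply: eq_integrable => // x _; rewrite /= mul1r.
Qed.

Lemma H1norm_sqr u : H1norm Omega u ^+ 2 = \int[mu2]_(x in Omega) jet_sqr u x.
Proof.
rewrite sqr_sqrtr// Rintegral_ge0// => x _.
by rewrite addr_ge0 ?sqr_ge0// sumr_ge0// => i _; rewrite sqr_ge0.
Qed.

(** A weak triangle inequality, enough to pass to the limit in sums. *)
Lemma H1norm_lin_sqr_le (c : R) u v : L2_jet u -> L2_jet v ->
  H1norm Omega (c *: u + v) ^+ 2 <=
  2 * c ^+ 2 * H1norm Omega u ^+ 2 + 2 * H1norm Omega v ^+ 2.
Proof.
move=> Lu Lv; rewrite !H1norm_sqr.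
have [Iu Iv] := (integrable_jet_sqr Lu, integrable_jet_sqr Lv).
rewrite -[X in _ <= _ + X]RintegralZl// -RIlin//; last exact: IZ.
apply: le_Rintegral => //; first exact/integrable_jet_sqr/L2_jet_lin.
  exact/Ilin/IZ.
move=> x _; rewrite /jet_sqr !big_ord_recl !big_ord0 /= !addr0.
have E (a b : R) : (c * a + b) ^+ 2 <= 2 * c ^+ 2 * a ^+ 2 + 2 * b ^+ 2.
  by have := sqr_ge0 (c * a - b); rewrite !expr2; lra.
have := E (u.1 x) (v.1 x).
have := E (grad u ord0 x) (grad v ord0 x).
have := E (grad u (lift ord0 ord0) x) (grad v (lift ord0 ord0) x).
rewrite /grad /=; set a1 := (_ + _) ^+ 2; set a2 := (_ + _) ^+ 2.
set a3 := (_ + _) ^+ 2.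
lra.
Qed.

Lemma zero_trace_lin G (c : R) u v : zero_trace Omega G u -> zero_trace Omega G v ->
  zero_trace Omega G (c *: u + v).
Proof.
move=> [Hu [h [sh h0 uh]]] [Hv [k [sk k0 vk]]]; split; first exact: H1_lin.
exists (fun n => c *: h n + k n); split=> [n|n x Gx|]; first exact: smooth_lin.
  have -> : (c *: h n + k n) x = c * h n x + k n x by [].
  by rewrite h0// k0// mulr0 addr0.
have sq_cvg : H1norm Omega (c *: u + v - jet_of (c *: h n + k n)) ^+ 2
    @[n --> \oo] --> (0 : R).
  apply: (squeeze_cvgr (f := fun _ => 0) (h := fun n =>
      2 * c ^+ 2 * H1norm Omega (u - jet_of (h n)) ^+ 2 +
      2 * H1norm Omega (v - jet_of (k n)) ^+ 2)).
  - near=> n; rewrite sqr_ge0/= jet_of_lin//.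
    have -> : c *: u + v - (c *: jet_of (h n) + jet_of (k n)) =
        c *: (u - jet_of (h n)) + (v - jet_of (k n)).
      by rewrite scalerBr opprD addrACA.
    by apply: H1norm_lin_sqr_le; apply: L2_jetB;
      [exact: H1_L2_jet|exact: L2_jet_of|exact: H1_L2_jet|exact: L2_jet_of].
  - exact: cvg_cst.
  - rewrite (_ : 0 = 2 * c ^+ 2 * (0 * 0) + 2 * (0 * 0)); last by ring.
    by apply: cvgD; apply: cvgMr; [exact: (cvgM uh uh)|exact: (cvgM vk vk)].
have := cvg_comp _ _ sq_cvg (@sqrt_continuous R 0); rewrite sqrtr0.
apply: cvg_trans; apply: near_eq_cvg; near=> n => /=.
by rewrite sqrtr_sqr ger0_norm// sqrtr_ge0.
Unshelve. all: by end_near. Qed.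

Lemma zero_trace0 G : zero_trace Omega G (0 : jet).
Proof.
split; first exact: H1_0.
exists (fun=> 0); split=> // [n|]; first exact: smooth0.
rewrite jet_of0 subr0 (_ : H1norm _ _ = 0); first exact: cvg_cst.
apply/eqP; rewrite -sqrf_eq0 H1norm_sqr; apply/eqP.
rewrite (_ : jet_sqr 0 = cst 0); first by rewrite Rintegral_cst// mul0r.
by apply/funext => x; rewrite /jet_sqr big1 => [|i _]; rewrite ?expr0n ?addr0.
Qed.

Lemma zero_trace_L2_jet G u : zero_trace Omega G u -> L2_jet u.
Proof. by move=> [/H1_L2_jet]. Qed.

End energy_space.

(** * The inner product given by the Dirichlet integral *)

Section energy_form.
Context {R : realType} (Omega : set (R * R)).
Context (Omega_open : open Omega).
Context (Omega_bounded : bounded_set Omega).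
Context (a : R * R -> 'M[R]_2) (alpha : R).
Context (a_bounded : bounded_coefficients Omega a).
Context (alpha_gt0 : 0 < alpha).
Context (a_elliptic : uniformly_elliptic Omega a alpha).
Local Notation plane := (R * R)%type.
Local Notation jet := ((plane -> R) * ('I_2 -> plane -> R))%type.
Local Notation mu2 := ((@lebesgue_measure R) \x (@lebesgue_measure R))%E.
Local Notation integ f := (mu2.-integrable Omega (EFin \o f)).
Local Notation L2_jet := (L2_jet Omega).
Implicit Types (u v w : jet).

Let mO : measurable Omega := open_measurable_plane Omega_open.
Let Isum := @integrable_fin_sum _ _ R mu2 Omega mO.
Let RIlin := @Rintegral_lin _ _ R mu2 Omega mO.

Definition energy_density u v x :=
  \sum_(i < 2) \sum_(j < 2) (a x i j * grad u j x * grad v i x).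

Definition dirichlet_density u v x :=
  \sum_(i < 2) (grad u i x * grad v i x).

Definition dirichlet u v := \int[mu2]_(x in Omega) dirichlet_density u v x.

Lemma integrable_dirichlet u v : L2_jet u -> L2_jet v ->
  integ (dirichlet_density u v).
Proof.
move=> [_ ui] [_ vi].
exact: (Isum (fun i => integrable_L2M Omega_open (ui i) (vi i))).
Qed.

Lemma integrable_energy u v : L2_jet u -> L2_jet v -> integ (energy_density u v).
Proof.
move=> [_ ui] [_ vi].
apply: (Isum (F := fun i x =>
  \sum_(j < 2) (a x i j * grad u j x * grad v i x))) => i.
apply: (Isum (F := fun j x => a x i j * grad u j x * grad v i x)) => j.
have [ma [M aM]] := a_bounded i j.
have := @integrable_ae_bounded_mul _ _ R mu2 Omega mO _ _ M ma aM
  (integrable_L2M Omega_open (ui j) (vi i)).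
by apply: eq_integrable => // x _; rewrite /= mulrA.
Qed.

Lemma dirichletC u v : dirichlet u v = dirichlet v u.
Proof.
by apply: eq_Rintegral => x _; apply: eq_bigr => i _; rewrite mulrC.
Qed.

Lemma dirichlet_linl (c : R) u v w : L2_jet u -> L2_jet v -> L2_jet w ->
  dirichlet (c *: u + v) w = c * dirichlet u w + dirichlet v w.
Proof.
move=> Lu Lv Lw.
rewrite -(RIlin c (integrable_dirichlet Lu Lw) (integrable_dirichlet Lv Lw)).
apply: eq_Rintegral => x _; rewrite /dirichlet_density mulr_sumr -big_split.
by apply: eq_bigr => i _; rewrite /grad/= mulrA -mulrDl.
Qed.

Lemma energy_linl (c : R) u v w : L2_jet u -> L2_jet v -> L2_jet w ->
  energy Omega a (c *: u + v) w = c * energy Omega a u w + energy Omega a v w.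
Proof.
move=> Lu Lv Lw.
rewrite -(RIlin c (integrable_energy Lu Lw) (integrable_energy Lv Lw)).
apply: eq_Rintegral => x _; rewrite /energy_density mulr_sumr -big_split.
apply: eq_bigr => i _; rewrite /= mulr_sumr -big_split.
apply: eq_bigr => j _; rewrite /grad/= mulrDr mulrDl; congr (_ + _).
rewrite -[(c *: u.2) j x]/(c * u.2 j x); ring.
Qed.

Lemma dirichlet_density_ge0 u x : 0 <= dirichlet_density u u x.
Proof. by apply: sumr_ge0 => i _; rewrite -expr2 sqr_ge0. Qed.

Lemma dirichlet_ge0 u : 0 <= dirichlet u u.
Proof. by apply: Rintegral_ge0 => x _; exact: dirichlet_density_ge0. Qed.

(** Ellipticity is a strict inequality for nonzero vectors; where the gradient
    vanishes both sides are 0. *)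
Lemma dirichlet_le_energy u : L2_jet u ->
  alpha * dirichlet u u <= energy Omega a u u.
Proof.
move=> Lu; rewrite -subr_ge0 addrC -mulNr.
rewrite -(RIlin (- alpha) (integrable_dirichlet Lu Lu) (integrable_energy Lu Lu)).
apply: Rintegral_ae_ge0 => //.
  exact: (@integrable_lin _ _ R mu2 Omega mO (- alpha) _ _
    (integrable_dirichlet Lu Lu) (integrable_energy Lu Lu)).
apply: ae_imply a_elliptic => x ell Ox; rewrite mulNr addrC subr_ge0.
pose xi : 'cV[R]_2 := \col_i grad u i x.
have dE : dirichlet_density u u x = \sum_(i < 2) xi i 0 ^+ 2.
  by apply: eq_bigr => i _; rewrite mxE expr2.
have eE : energy_density u u x = (xi^T *m a x *m xi) 0 0.
  rewrite mxE /energy_density exchange_big; apply: eq_bigr => j _ /=.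
  rewrite !mxE mulr_suml; apply: eq_bigr => i _; rewrite !mxE; ring.
rewrite dE eE; have [->|xi0] := eqVneq xi 0; last exact/ltW/ell.
by rewrite mulmx0 mxE big1 ?mulr0// => i _; rewrite mxE expr0n.
Qed.

Lemma dirichlet_eq0_grad u : L2_jet u -> dirichlet u u = 0 ->
  {ae mu2, forall x, Omega x -> forall i, grad u i x = 0}.
Proof.
move=> Lu /(@Rintegral_ge0_eq0 _ _ R mu2 Omega mO _ (integrable_dirichlet Lu Lu)
  (fun x _ => dirichlet_density_ge0 u x)).
apply: ae_imply => x Hx Ox i; move: (Hx Ox) => /eqP.
rewrite psumr_eq0 => [/allP/(_ i (mem_index_enum _))|j _].
  by rewrite mulf_eq0 orbb => /eqP.
by rewrite -expr2 sqr_ge0.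
Qed.

Lemma dirichlet_eq0 u v : L2_jet u -> L2_jet v -> dirichlet u u = 0 ->
  dirichlet u v = 0.
Proof.
move=> Lu Lv u0; transitivity (\int[mu2]_(x in Omega) (cst 0 x : R)); last first.
  by rewrite Rintegral_cst// mul0r.
apply: Rintegral_ae_eq => //.
  by have /integrableP[/measurable_EFinP] := integrable_dirichlet Lu Lv.
apply: ae_imply (dirichlet_eq0_grad Lu u0) => x g0 Ox.
by apply: big1 => i _; rewrite g0// mul0r.
Qed.

Lemma energy_eq0 u v : L2_jet u -> L2_jet v -> dirichlet u u = 0 ->
  energy Omega a u v = 0.
Proof.
move=> Lu Lv u0; transitivity (\int[mu2]_(x in Omega) (cst 0 x : R)); last first.
  by rewrite Rintegral_cst// mul0r.
apply: Rintegral_ae_eq => //.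
  by have /integrableP[/measurable_EFinP] := integrable_energy Lu Lv.
apply: ae_imply (dirichlet_eq0_grad Lu u0) => x g0 Ox.
by apply: big1 => i _; apply: big1 => j _; rewrite g0// mulr0 mul0r.
Qed.

Context (G1 G2 : set plane).
Context (solvable_n : mixed_solvable Omega a G1 G2).
Local Notation H := (H00dual Omega G2 G1).
Local Notation W := (@Wsol R Omega a G1 G2).
Implicit Types phi psi chi : H.

Lemma Wsol_spec phi : zero_trace Omega G1 (W phi) /\ conormal a (W phi) phi.
Proof.
have [|w ws] := solvable_n (f := trace Omega G1 0) phi.
  by exists 0 => //; exact: H1_0.
have : mixed_solution a (trace Omega G1 0) phi (W phi).
  exact: (xgetPex 0 (ex_intro _ w ws)).
move=> [HW _ tW cW]; split; last exact: cW.
have : trace Omega G1 (W phi) (W phi).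
  split; first exact: HW.
  by rewrite subrr; exact: zero_trace0.
by rewrite tW => -[_]; rewrite subr0.
Qed.

Lemma Wsol_L2_jet phi : L2_jet (W phi).
Proof. by have [/zero_trace_L2_jet] := Wsol_spec phi. Qed.

(** The solutions [W] are linear up to a function [d] of zero trace on [G1] and
    zero conormal derivative on [G2]; testing the latter with [d] itself gives
    zero energy, hence a zero gradient. *)
Lemma Wsol_lin (c : R) phi psi w : L2_jet w ->
  dirichlet (W (c *: phi + psi)) w = dirichlet (c *: W phi + W psi) w.
Proof.
move=> Lw.
have [z1 e1] := Wsol_spec phi; have [z2 e2] := Wsol_spec psi.
have [z3 e3] := Wsol_spec (c *: phi + psi).
have z12 := zero_trace_lin Omega_open Omega_bounded c z1 z2.
pose d := - 1 *: (c *: W phi + W psi) + W (c *: phi + psi).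
have zd : zero_trace Omega G1 d by exact: zero_trace_lin.
have [l1 l2] := (zero_trace_L2_jet z1, zero_trace_L2_jet z2).
have [l3 l12] := (zero_trace_L2_jet z3, zero_trace_L2_jet z12).
have ld := zero_trace_L2_jet zd.
have d0 : dirichlet d d = 0.
  apply/eqP; rewrite eq_le dirichlet_ge0 andbT -(ler_pM2l alpha_gt0) mulr0.
  apply: le_trans (dirichlet_le_energy ld) _.
  rewrite {1}/d (energy_linl (-1) l12 l3 ld) (energy_linl c l1 l2 ld).
  rewrite (e1 d zd) (e2 d zd) (e3 d zd).
  rewrite -[(c *: phi + psi) d]/(c * phi d + psi d).
  by rewrite mulN1r addNr.
have := dirichlet_eq0 ld Lw d0.
rewrite (dirichlet_linl (-1) l12 l3 Lw).
by rewrite mulN1r addrC => /eqP; rewrite subr_eq0 => /eqP.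
Qed.

Lemma star_semi_inner : semi_inner (@star R Omega a G1 G2).
Proof.
split=> [c phi psi chi|phi psi|phi].
- rewrite -[LHS]/(dirichlet (W (c *: phi + psi)) (W chi)).
  rewrite (Wsol_lin c phi psi (Wsol_L2_jet chi)).
  exact: dirichlet_linl (Wsol_L2_jet phi) (Wsol_L2_jet psi) (Wsol_L2_jet chi).
- exact: dirichletC.
- exact: dirichlet_ge0.
Qed.

(** A zero gradient has zero energy against every function, and this energy is
    the functional [phi]. *)
Lemma star_definite phi : star a phi phi = 0 -> phi = 0.
Proof.
move=> phi0; have [zW eW] := Wsol_spec phi.
apply: val_inj; apply/funext => v /=.
have [p1 _ _ _] := asboolP _ (valP phi).
have [zv|nzv] := pselect (zero_trace Omega G1 v); last by rewrite p1.
rewrite -(eW v zv).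
exact: (energy_eq0 (Wsol_L2_jet phi) (zero_trace_L2_jet zv) phi0).
Qed.

End energy_form.

(** * The rates of the discrepancy principle *)

Theorem theorem15 (R : realType) (Omega G1 G2 : set (R * R))
    (a : R * R -> 'M[R]_2) (alpha : R)
    (Omega_regular : regular_domain Omega)
    (G12_split : boundary_split Omega G1 G2)
    (a_bounded : bounded_coefficients Omega a)
    (alpha_gt0 : 0 < alpha)
    (a_elliptic : uniformly_elliptic Omega a alpha)
    (solvable_n : mixed_solvable Omega a G1 G2)
    (solvable_d : mixed_solvable Omega a G2 G1)
    (Tl_selfadjoint : forall phi psi : H00dual Omega G2 G1,
       star a (Tl a phi) psi = star a phi (Tl a psi))
    (Tl_nonnegative : forall phi : H00dual Omega G2 G1,
       0 <= star a (Tl a phi) phi)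
    (Tl_nonexpansive : forall phi : H00dual Omega G2 G1,
       starnorm a (Tl a phi) <= starnorm a phi)
    (f : set ((R * R -> R) * ('I_2 -> R * R -> R))) (g : H00dual Omega G1 G2)
    (f_Hhalf : Hhalf Omega G1 f)
    (fg_consistent : consistent a f g)
    (phibar phi1 psi : H00dual Omega G2 G1) (p mu : R)
    (phibar_fixed : Tl a phibar + zterm a f g = phibar)
    (p_ge1 : 1 <= p)
    (source_condition : continuous_calculus (@starnorm R Omega a G1 G2) (source_fun p)
       (fun phi => phi - Tl a phi) psi (phibar - phi1))
    (mu_gt2 : 2 < mu)
    (feps : R -> set ((R * R -> R) * ('I_2 -> R * R -> R)))
    (geps : R -> H00dual Omega G1 G2)
    (feps_Hhalf : forall eps, 0 < eps -> Hhalf Omega G1 (feps eps))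
    (noise : forall eps, 0 < eps ->
       starnorm a (zterm a (feps eps) (geps eps) - zterm a f g) <= eps) :
  exists k : R -> nat,
    [/\ forall eps, 0 < eps ->
          discrepancy_index a phi1 (zterm a (feps eps) (geps eps)) (mu * eps) (k eps),
        (fun eps : R => (k eps)%:R * ln (k eps)%:R `^ p)
          =O_ ((0 : R)^'+) (fun eps : R => eps^-1) &
        (fun eps : R => starnorm a (phibar -
             iterate a phi1 (zterm a (feps eps) (geps eps)) (k eps)))
          =O_ ((0 : R)^'+) (fun eps : R => (- ln (Num.sqrt eps)) `^ (- p))].
Proof.
have [openO boundedO _] := Omega_regular.
have B_inner := star_semi_inner openO boundedO a_bounded alpha_gt0
  a_elliptic solvable_n.
have Hdef := star_definite openO boundedO a_bounded solvable_n.
have mu_gt1 : 1 < mu by apply: lt_trans mu_gt2; rewrite ltr1n.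
have p_gt0 : 0 < p by exact: lt_le_trans p_ge1.
pose zeps eps := zterm a (feps eps) (geps eps).
pose res eps :=
  fp_residual (@star R Omega a G1 G2) (@Tl R Omega a G1 G2) phi1 (zeps eps).
have stops := discrepancy_stops B_inner Hdef Tl_selfadjoint Tl_nonnegative
  Tl_nonexpansive phibar_fixed p_gt0 source_condition mu_gt1 noise.
have [C1 C1_gt0 index_rate] := stopping_index_rate B_inner Hdef Tl_selfadjoint
  Tl_nonnegative Tl_nonexpansive phibar_fixed p_gt0 source_condition mu_gt1 noise.
have [C2 C2_gt0 error_rate] := logarithmic_rate B_inner Hdef Tl_selfadjoint
  Tl_nonnegative Tl_nonexpansive phibar_fixed p_gt0 source_condition mu_gt1 noise.
pose stop eps n := res eps n <= mu * eps /\
  forall j, (j < n)%N -> mu * eps < res eps j.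
have /choice[n nP] : forall eps, exists n, 0 < eps -> stop eps n.
  move=> eps; have [e0|e0] := ltP 0 eps; last by exists 0%N.
  by have [n n1 n2] := stops eps e0; exists n.
exists (fun eps => (n eps).+1); split=> [eps e0||].
- have [n1 n2] := nP eps e0; split=> // j /andP[j0 jn].
  by apply: (n2 j.-1); rewrite -ltnS prednK.
- apply/eqO_exP; exists C1 => //; near=> eps.
  have e0 : 0 < eps by near: eps; exact: nbhs_right_gt.
  have [_ n2] := nP eps e0.
  rewrite ger0_norm ?mulr_ge0 ?powR_ge0// ger0_norm ?invr_ge0 ?(ltW e0)//.
  exact: index_rate.
- apply/eqO_exP; exists C2 => //; near=> eps.
  have e0 : 0 < eps by near: eps; exact: nbhs_right_gt.
  have e1 : eps < 1 by near: eps; exact: nbhs_right_lt.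
  have [n1 n2] := nP eps e0.
  rewrite ger0_norm ?sqrtr_ge0// ger0_norm ?powR_ge0//.
  by apply: error_rate; rewrite ?e0.
Unshelve. all: by end_near. Qed.
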